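(* Assume (SH) and (H), and let $\phi:\mathbb{R}^n\to\mathbb{R}$ be locally Lipschitz. Let $\overline{x}:[t_0,T]\to\mathbb{R}^n$ be optimal for $\mathcal{P}(t_0,x_0)$ and let $\overline{p}:[t_0,T]\to\mathbb{R}^n$ be an arc such that $(\overline{x},\overline{p})$ satisfies, for a.e. $s\in[t_0,T]$, $$\dot{\overline{x}}(s)\in\partial_p^-H(\overline{x}(s),\overline{p}(s)),\qquad -\dot{\overline{p}}(s)\in\partial_x^-H(\overline{x}(s),\overline{p}(s)),$$ together with $\overline{x}(t_0)=x_0$ and $-\overline{p}(t_0)\in\partial_x^{-}V(t_0,x_0)$. Then $$-\overline{p}(t)\in\partial_x^-V(t,\overline{x}(t))\quad\text{for all }t\in[t_0,T].$$
   Context: Fix $T\in\mathbb{R}$, a multifunction $F:\mathbb{R}^n\rightrightarrows\mathbb{R}^n$ and $\phi:\mathbb{R}^n\to\mathbb{R}$. An arc is an absolutely continuous function on a compact interval. For $(t_0,x_0)\in(-\infty,T]\times\mathbb{R}^n$, the Mayer problem $\mathcal{P}(t_0,x_0)$ is to minimize $\phi(x(T))$ over all arcs $x:[t_0,T]\to\mathbb{R}^n$ with $\dot x(s)\in F(x(s))$ for a.e. $s\in[t_0,T]$ and $x(t_0)=x_0$; a minimizer is called optimal for $\mathcal{P}(t_0,x_0)$. The value function $V:(-\infty,T]\times\mathbb{R}^n\to\mathbb{R}$ is the infimum $V(t_0,x_0)$ of this problem. The Hamiltonian is $H(x,p)=\sup_{v\in F(x)}\langle v,p\rangle$, $x,p\in\mathbb{R}^n$.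 (SH): (i) $F(x)$ is nonempty, convex, compact for each $x$; (ii) $F$ is locally Lipschitz, i.e. each $x$ has a neighborhood $K$ and a constant $c>0$ with $F(z)\subset F(y)+c|z-y|B(0,1)$ for all $z,y\in K$; (iii) there is $\gamma>0$ with $\max\{|v|:v\in F(x)\}\le\gamma(1+|x|)$ for all $x$. (H): for every $r>0$: (i) there is $c\ge0$ such that for all $p\in S^{n-1}$ (unit sphere) the map $x\mapsto H(x,p)$ is semiconvex on $B(0,r)$ with constant $c$; (ii) $\nabla_pH(x,p)$ exists and is Lipschitz in $x$ on $B(0,r)$, uniformly for $p\in\mathbb{R}^n\setminus\{0\}$. A function $f$ is semiconcave on $\Omega$ (with constant $c$) if it is continuous and $f(x+h)+f(x-h)-2f(x)\le c|h|^2$ whenever $[x-h,x+h]\subset\Omega$; $f$ is semiconvex if $-f$ is semiconcave. $B(x,\epsilon)$ is the closed ball. The Fréchet subdifferential of $f$ at $x$ is $\partial^-f(x)=\{p:\liminf_{y\to x}\frac{f(y)-f(x)-\langle p,y-x\rangle}{|y-x|}\ge0\}$; $\partial_x^-H$, $\partial_p^-H$ denote the Fréchet subdifferentials of $H(\cdot,p)$ and $H(x,\cdot)$, and $\partial_x^-V(t,x)$ that of $V(t,\cdot)$ at $x$. *)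

(* Defs.v *)
From HB Require Import structures.
From mathcomp Require Import all_boot all_order all_algebra.
From mathcomp Require Import all_classical all_reals all_analysis.

Set Implicit Arguments.
Unset Strict Implicit.
Unset Printing Implicit Defensive.

Import Order.TTheory GRing.Theory Num.Theory.
Import numFieldNormedType.Exports.

Local Open Scope classical_set_scope.
Local Open Scope ring_scope.

(* R^n is 'rV[R]_n.  The library norm `|x| on it is the max norm: it gives the
   usual topology and derivatives, but every norm written |x| in the
   mathematics, including those defining balls and spheres, is [enorm]. *)
Section euclidean.
Context {R : realType} {n : nat}.
Implicit Types x y : 'rV[R]_n.

Definition dot x y : R := \sum_i x 0 i * y 0 i.

Definition enorm x : R := Num.sqrt (dot x x).

Definition cball x (r : R) : set 'rV[R]_n := [set y | enorm (y - x) <= r].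

Definition gradient (f : 'rV[R]_n -> R) x : 'rV[R]_n :=
  \row_i 'D_(delta_mx 0 i) f x.

Definition locally_lipschitz (f : 'rV[R]_n -> R) : Prop :=
  forall x, exists2 K : set 'rV[R]_n, nbhs x K &
    exists2 c : R, 0 < c &
      forall y z, K y -> K z -> `|f z - f y| <= c * enorm (z - y).

Definition semiconcave (Om : set 'rV[R]_n) (c : R) (f : 'rV[R]_n -> R) : Prop :=
  {within Om, continuous f} /\
  forall x h, (forall l : R, -1 <= l <= 1 -> Om (x + l *: h)) ->
    f (x + h) + f (x - h) - 2 * f x <= c * enorm h ^+ 2.

Definition semiconvex (Om : set 'rV[R]_n) (c : R) (f : 'rV[R]_n -> R) : Prop :=
  semiconcave Om c (fun x => - f x).

Definition frechet_subdiff (f : 'rV[R]_n -> R) x : set 'rV[R]_n :=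
  [set p | (0 <= limf_einf
    (fun y => ((f y - f x - dot p (y - x)) / enorm (y - x))%:E) x^')%E].

End euclidean.

Section mayer.
Context {R : realType} {n : nat}.
Implicit Types (F : 'rV[R]_n -> set 'rV[R]_n) (phi : 'rV[R]_n -> R).
Implicit Types (a b t : R) (x : 'rV[R]_n) (g y : R -> 'rV[R]_n).

(* A map on [a, b] is a total map whose values outside [a, b] play no role. *)
Definition is_arc a b g : Prop :=
  forall e : R, 0 < e -> exists2 d : R, 0 < d &
    forall (m : nat) (u v : 'I_m -> R),
      (forall i, [/\ a <= u i, u i <= v i & v i <= b]) ->
      trivIset setT (fun i => `]u i, v i[%classic) ->
      \sum_i (v i - u i) < d ->
      \sum_i enorm (g (v i) - g (u i)) < e.

Definition trajectory F T t x y : Prop :=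
  [/\ is_arc t T y,
      {ae (@lebesgue_measure R), forall s, s \in `[t, T] ->
        derivable y s 1 /\ F (y s) (derive1 y s)}
    & y t = x].

Definition optimal F phi T t x y : Prop :=
  trajectory F T t x y /\
  forall z, trajectory F T t x z -> phi (y T) <= phi (z T).

(* [inf] and [sup] are the real-valued ones, meaningful only for nonempty sets
   bounded on the relevant side; under [SH], with phi locally Lipschitz, this
   holds for the sets used in [value] (for t <= T) and [hamiltonian]. *)
Definition value F phi T t x : R :=
  inf [set phi (y T) | y in trajectory F T t x].

Definition hamiltonian F x (p : 'rV[R]_n) : R := sup [set dot v p | v in F x].

Definition SH F : Prop :=
  [/\ forall x, [/\ F x !=set0, convex_set (F x) & compact (F x)],
      forall x, exists2 K : set 'rV[R]_n, nbhs x K &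
        exists2 c : R, 0 < c & forall z w, K z -> K w ->
          F z `<=` [set v + (c * enorm (z - w)) *: b
                   | v in F w & b in cball 0 1]
    & exists2 gamma : R, 0 < gamma &
        forall x v, F x v -> enorm v <= gamma * (1 + enorm x)].

Definition H_semiconvex F (r : R) : Prop :=
  exists2 c : R, 0 <= c & forall p : 'rV[R]_n, enorm p = 1 ->
    semiconvex (cball 0 r) c (fun x => hamiltonian F x p).

Definition H_gradient_lipschitz F (r : R) : Prop :=
  (forall x p : 'rV[R]_n, cball 0 r x -> p != 0 ->
    differentiable (hamiltonian F x) p) /\
  exists2 k : R, 0 <= k & forall p : 'rV[R]_n, p != 0 ->
    forall x z, cball 0 r x -> cball 0 r z ->
      enorm (gradient (hamiltonian F x) p - gradient (hamiltonian F z) p)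
        <= k * enorm (x - z).

Definition HH F : Prop :=
  forall r : R, 0 < r -> H_semiconvex F r /\ H_gradient_lipschitz F r.

End mayer.

(* Main.v *)
Require Import Defs.
From HB Require Import structures.
From mathcomp Require Import all_boot all_order all_algebra.
From mathcomp Require Import all_classical all_reals all_analysis.
From mathcomp Require Import ring lra.

(** Let x be close to xbar t. If x can be pulled back along a trajectory of F to a
    point z at time t0, then the dynamic programming principle gives
    V t0 z <= V t x, while V t (xbar t) <= V t0 x0 because xbar is optimal.
    Hence the subgradient inequality for V t0 at x0, applied to z, bounds
    V t x - V t (xbar t) from below by - dot (pbar t0) (z - x0), up to a small
    multiple of |z - x0|. It remains to choose z with |z - x0| = O(|x - xbar t|)
    and dot (pbar t0) (z - x0) at most dot (pbar t) (x - xbar t) plus a quadratic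
    error: this is the predicate [transports].

    Since -pbar' is a subgradient of H in x and H is Lipschitz in x with constant
    k |p|, the costate vanishes everywhere or nowhere ([adjoint_gronwall]).

    If it never vanishes, z is obtained from the flow of the gradient field
    y -> grad_p H y (pbar s), of which xbar is a solution ([transport_adjoint]).
    The field is continuous in s because F is compact-valued and the maximizing
    velocity is unique, and Lipschitz in y by assumption; so the flow exists
    ([picard]) and Gronwall's inequality compares it with xbar. Along the flow
    the pairing of pbar with y - xbar has derivative
    H y pbar - H xbar pbar + dot pbar' (y - xbar), which is at least
    - C |y - xbar|^2 because - pbar' is a subgradient and H is semiconvex in x
    ([semiconvex_subgradient]).

    If it vanishes, only the estimate |z - x0| = O(|x - xbar t|) is needed, as in
    Filippov's theorem, but the velocity of xbar may be interior to F. Time is cut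
    into steps no longer than |x - xbar t|. On each step the mean velocity of xbar
    is approximated by a Lipschitz selection of F, whose existence follows from
    separation ([lip_selection_approx]), and the flow of that selection is
    followed backwards ([tracking_step]); the errors add up to O(|x - xbar t|)
    ([transport_tracking]).

    Trajectories are differentiable only almost everywhere; every estimate along
    them reduces to the monotonicity of an absolutely continuous function whose
    derivative is almost everywhere nonnegative ([abs_cont_ndecr]). *)

Set Implicit Arguments.
Unset Strict Implicit.
Unset Printing Implicit Defensive.

Import Order.TTheory GRing.Theory Num.Theory.
Import numFieldNormedType.Exports.

Local Open Scope classical_set_scope.
Local Open Scope ring_scope.

(** * Euclidean structure on row vectors *)

Section euclid.
Context {R : realType} {n : nat}.
Implicit Types (x y z : 'rV[R]_n) (c : R).

Lemma dotC x y : dot x y = dot y x.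
Proof. by apply: eq_bigr => i _; rewrite mulrC. Qed.

Lemma dotDl x y z : dot (x + y) z = dot x z + dot y z.
Proof. by rewrite -big_split; apply: eq_bigr => i _; rewrite !mxE mulrDl. Qed.

Lemma dotDr x y z : dot z (x + y) = dot z x + dot z y.
Proof. by rewrite dotC dotDl !(dotC z). Qed.

Lemma dotZl c x y : dot (c *: x) y = c * dot x y.
Proof. by rewrite mulr_sumr; apply: eq_bigr => i _; rewrite !mxE mulrA. Qed.

Lemma dotZr c x y : dot x (c *: y) = c * dot x y.
Proof. by rewrite dotC dotZl dotC. Qed.

Lemma dotNl x y : dot (- x) y = - dot x y.
Proof. by rewrite -scaleN1r dotZl mulN1r. Qed.

Lemma dotNr x y : dot x (- y) = - dot x y.
Proof. by rewrite dotC dotNl dotC. Qed.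

Lemma dotBl x y z : dot (x - y) z = dot x z - dot y z.
Proof. by rewrite dotDl dotNl. Qed.

Lemma dotBr x y z : dot z (x - y) = dot z x - dot z y.
Proof. by rewrite dotDr dotNr. Qed.

Lemma dot0l x : dot 0 x = 0.
Proof. by rewrite -(scale0r x) dotZl mul0r. Qed.

Lemma dot0r x : dot x 0 = 0.
Proof. by rewrite dotC dot0l. Qed.

Lemma dot_delta i x : dot (delta_mx 0 i) x = x 0 i.
Proof.
rewrite /dot (bigD1 i)//= big1 => [|j ji]; rewrite !mxE eqxx/=.
  by rewrite eqxx mul1r addr0.
by rewrite (negbTE ji) mul0r.
Qed.

Lemma dotxx_ge0 x : 0 <= dot x x.
Proof. by apply: sumr_ge0 => i _; rewrite -expr2 sqr_ge0. Qed.

Lemma enorm_ge0 x : 0 <= enorm x.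
Proof. exact: sqrtr_ge0. Qed.

Lemma sqr_enorm x : enorm x ^+ 2 = dot x x.
Proof. by rewrite sqr_sqrtr ?dotxx_ge0. Qed.

Lemma enormZ c x : enorm (c *: x) = `|c| * enorm x.
Proof.
rewrite /enorm dotZl dotZr mulrA -expr2 sqrtrM ?sqr_ge0//.
by rewrite sqrtr_sqr.
Qed.

Lemma enormN x : enorm (- x) = enorm x.
Proof. by rewrite -scaleN1r enormZ normrN1 mul1r. Qed.

Lemma enorm_sym x y : enorm (x - y) = enorm (y - x).
Proof. by rewrite -enormN opprB. Qed.

Lemma enorm0 : enorm (0 : 'rV[R]_n) = 0.
Proof. by rewrite /enorm dot0l sqrtr0. Qed.

Lemma coord_le_enorm x i : `|x 0 i| <= enorm x.
Proof.
rewrite -(sqrtr_sqr (x 0 i)) ler_wsqrtr// /dot (bigD1 i)//= -expr2.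
by rewrite lerDl sumr_ge0// => j _; rewrite -expr2 sqr_ge0.
Qed.

Lemma enorm_eq0 x : (enorm x == 0) = (x == 0).
Proof.
apply/idP/eqP => [/eqP x0|->]; last by rewrite enorm0.
apply/rowP => i; rewrite mxE; apply/eqP.
by rewrite -normr_le0 -x0 coord_le_enorm.
Qed.

Lemma enorm_gt0 x : (0 < enorm x) = (x != 0).
Proof. by rewrite lt_neqAle enorm_ge0 andbT eq_sym enorm_eq0. Qed.

Lemma dot_le_enorm x y : `|dot x y| <= enorm x * enorm y.
Proof.
rewrite -ler_sqr ?nnegrE ?mulr_ge0 ?enorm_ge0// exprMn !sqr_enorm.
rewrite real_normK ?num_real//.
have [->|y0] := eqVneq y 0; first by rewrite !dot0r expr0n mulr0.
have yy : 0 < dot y y by rewrite -sqr_enorm exprn_gt0 // enorm_gt0.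
rewrite -subr_ge0 -(pmulr_rge0 _ yy).
have := dotxx_ge0 (dot y y *: x - dot x y *: y).
rewrite dotBl !dotBr !dotZl !dotZr (dotC y x) => H.
by apply: le_trans H _; rewrite le_eqVlt; apply/orP; left; apply/eqP; ring.
Qed.

Lemma dot_le x y : dot x y <= enorm x * enorm y.
Proof. exact: le_trans (ler_norm _) (dot_le_enorm x y). Qed.

Lemma dot_ge x y : - (enorm x * enorm y) <= dot x y.
Proof. by have := dot_le_enorm x y; rewrite ler_norml => /andP[]. Qed.

Lemma enormD x y : enorm (x + y) <= enorm x + enorm y.
Proof.
rewrite -ler_sqr ?nnegrE ?addr_ge0 ?enorm_ge0//.
rewrite sqr_enorm dotDl !dotDr sqrrD !sqr_enorm (dotC y x).
have := dot_le x y; lra.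
Qed.

Lemma sqr_enormB x y :
  enorm (x - y) ^+ 2 = enorm x ^+ 2 - 2 * dot x y + enorm y ^+ 2.
Proof. by rewrite !sqr_enorm dotBl !dotBr (dotC y x); ring. Qed.

Lemma enorm_triangle z x y : enorm (x - y) <= enorm (x - z) + enorm (z - y).
Proof. by rewrite -(subrKA z) enormD. Qed.

Lemma norm_le_enorm x : `|x| <= enorm x.
Proof.
rewrite [leLHS]/Num.Def.normr/= mx_normrE; apply: bigmax_le => [|[i j] _].
  exact: enorm_ge0.
by rewrite ord1 coord_le_enorm.
Qed.

Lemma coord_le_norm x i : `|x 0 i| <= `|x|.
Proof.
rewrite [leRHS]/Num.Def.normr/= mx_normrE.
exact: (le_bigmax _ (fun ij : 'I_1 * 'I_n => `|x ij.1 ij.2|) (0, i)).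
Qed.

Lemma norm_le_coord x c : 0 <= c -> (forall i, `|x 0 i| <= c) -> `|x| <= c.
Proof.
move=> c0 xc; rewrite [leLHS]/Num.Def.normr/= mx_normrE.
by apply: bigmax_le => // -[i j] _; rewrite ord1 xc.
Qed.

Lemma enorm_le_norm x : enorm x <= n%:R * `|x|.
Proof.
rewrite -ler_sqr ?nnegrE ?mulr_ge0 ?enorm_ge0// sqr_enorm exprMn.
apply: (@le_trans _ _ (n%:R * `|x| ^+ 2)).
  rewrite mulrC mulr_natr -[X in _ *+ X]card_ord -sumr_const.
  apply: ler_sum => i _; rewrite -expr2 -real_normK ?num_real//.
  by rewrite ler_sqr ?nnegrE// coord_le_norm.
rewrite ler_wpM2r ?sqr_ge0// -natrX ler_nat.
by case: (n) => // m; rewrite leq_pmulr.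
Qed.

Lemma near_enormP x (P : set 'rV[R]_n) :
  nbhs x P <-> exists2 e : R, 0 < e & forall y, enorm (y - x) < e -> P y.
Proof.
split=> [/nbhs_ballP[e /= e0 xP]|[e e0 xP]].
  exists e => // y yx; apply: xP; rewrite mx_norm_ball /ball_/= distrC.
  exact: le_lt_trans (norm_le_enorm _) yx.
apply/nbhs_ballP; exists (e / n.+1%:R) => /=; first by rewrite divr_gt0.
move=> y; rewrite mx_norm_ball /ball_/= distrC => yx; apply: xP.
apply: le_lt_trans (enorm_le_norm _) _.
rewrite ltr_pdivlMr// in yx; rewrite mulrC (le_lt_trans _ yx)//.
by rewrite ler_wpM2l// ler_nat.
Qed.

(** The liminf over the punctured neighbourhood becomes an inequality multiplied out
    by the distance, which also holds at the point itself and can be composed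
    with changes of variables. *)
Lemma frechet_subdiffP (f : 'rV[R]_n -> R) x p :
  frechet_subdiff f x p <-> forall e : R, 0 < e ->
    exists2 d : R, 0 < d & forall y, enorm (y - x) < d ->
      - (e * enorm (y - x)) <= f y - f x - dot p (y - x).
Proof.
rewrite /frechet_subdiff /= limf_einfE; set q := fun y => _.
have qE y c : y != x -> (c <= ((f y - f x - dot p (y - x)) / enorm (y - x)))
    = (c * enorm (y - x) <= f y - f x - dot p (y - x)).
  by move=> yx; rewrite ler_pdivlMr// enorm_gt0 subr_eq0.
split=> [H e e0|H].
  have : ((- e)%:E < ereal_sup [set ereal_inf (q @` V) | V in x^'])%E.
    by apply: lt_le_trans H; rewrite lte_fin oppr_lt0.
  move=> /ereal_sup_gt[_ [V xV <-] eV].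
  have /near_enormP[d d0 dV] : nbhs x (fun y => y != x -> V y) by exact: xV.
  exists d => // y yd; have [->|yx] := eqVneq y x.
    by rewrite !subrr enorm0 dot0r mulr0 subrr oppr0.
  rewrite -mulNr -qE// -lee_fin (le_trans (ltW eV))//.
  by apply: ereal_inf_lbound; exists y => //; exact: dV.
apply/lee_addgt0Pr => e e0; have [d d0 dP] := H _ e0.
rewrite -leeBlDr// sub0e; apply: le_ereal_sup_tmp.
exists (ereal_inf (q @` [set y | y != x /\ enorm (y - x) < d])).
  exists [set y | y != x /\ enorm (y - x) < d] => //.
  by apply/near_enormP; exists d.
apply: le_ereal_inf_tmp => _ [y [yx yd] <-].
by rewrite lee_fin qE// mulNr dP.
Qed.

End euclid.

(** * Monotonicity of absolutely continuous functions *)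

Section abs_cont.
Context {R : realType}.
Implicit Types (a b : R) (f g : R -> R).

(** The scalar counterpart of [is_arc]: products, which take norms and pairings of
    arcs to real functions, are handled at this level. *)
Definition abs_cont a b g : Prop :=
  forall e : R, 0 < e -> exists2 d : R, 0 < d &
    forall (m : nat) (u v : 'I_m -> R),
      (forall i, [/\ a <= u i, u i <= v i & v i <= b]) ->
      trivIset setT (fun i => `]u i, v i[%classic) ->
      \sum_i (v i - u i) < d ->
      \sum_i `|g (v i) - g (u i)| < e.

Lemma sum_itv_lt_of_measure m (u v : 'I_m -> R) (U : set R) (c : R) :
  (forall i, u i <= v i) -> trivIset setT (fun i => `]u i, v i[%classic) ->
  (forall i, `]u i, v i[ `<=` U) -> measurable U ->
  (lebesgue_measure U < c%:E)%E -> \sum_i (v i - u i) < c.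
Proof.
move=> uv tuv uvU mU Uc; rewrite -lte_fin; apply: le_lt_trans Uc.
have -> : (\sum_i (v i - u i))%:E =
    lebesgue_measure (\big[setU/set0]_(i < m) `]u i, v i[%classic).
  rewrite measure_semi_additive_ord//; last exact: bigsetU_measurable.
  rewrite -sumEFin; apply: eq_bigr => i _.
  rewrite [RHS]lebesgue_measure_itv/= lte_fin -EFinB.
  case: ltP => // vu; congr EFin; apply/eqP.
  by rewrite eq_sym -subr_le0 in vu *; rewrite eq_le vu subr_ge0 uv.
apply: le_measure; rewrite ?inE//; first exact: bigsetU_measurable.
by apply: (big_ind (fun A => A `<=` U)) => // A B AU BU x [/AU|/BU].
Qed.

Lemma derivable_slope_ge g s (e : R) : derivable g s 1 -> 0 <= derive1 g s ->
  0 < e -> exists2 d : R, 0 < d & forall u v, u <= s <= v -> s - d < u ->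
    v < s + d -> - (e * (v - u)) <= g v - g u.
Proof.
move=> gs gs0 e0.
have : h^-1 *: (g (h *: 1 + s) - g s) @[h --> 0^'] --> derive1 g s.
  by rewrite derive1E; exact: gs.
move=> /cvgrPdist_lt/(_ _ e0).
move=> [d /= d0 dP]; exists d => // u v /andP[us sv] su vs.
have slope h : `|h| < d -> h != 0 -> - e < h^-1 * (g (h + s) - g s).
  move=> hd h0; have := dP h; rewrite /ball_ /= sub0r normrN => /(_ hd h0).
  rewrite [_%:A]mulr1 ltr_distlC => /andP[+ _].
  by apply: le_lt_trans; rewrite lerBrDr addNr.
have gu : - (e * (s - u)) <= g s - g u.
  move: us; rewrite le_eqVlt => /orP[/eqP ->|us]; first by rewrite !subrr mulr0 oppr0.
  have := slope (u - s).
  rewrite subrK distrC gtr0_norm ?subr_gt0// subr_eq0 (lt_eqF us).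
  rewrite ltrBlDr -ltrBlDl su => /(_ isT isT); rewrite mulrC.
  rewrite ltr_ndivlMr ?subr_lt0//; lra.
have gv : - (e * (v - s)) <= g v - g s.
  move: sv; rewrite le_eqVlt => /orP[/eqP ->|sv]; first by rewrite !subrr mulr0 oppr0.
  have := slope (v - s).
  rewrite subrK gtr0_norm ?subr_gt0// subr_eq0 (gt_eqF sv).
  rewrite ltrBlDl vs => /(_ isT isT); rewrite mulrC.
  rewrite ltr_pdivlMr ?subr_gt0//; lra.
lra.
Qed.

Section monotone.
Variables (a b : R) (g : R -> R).
Hypothesis ab : a <= b.

(** Bookkeeping for the covering argument: on [a, s] the function loses at most
    e (s - a), apart from its variation over finitely many disjoint intervals
    inside U, which absolute continuity makes small when U is small. *)
Let descent (U : set R) (e s : R) :=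
  exists m, exists u v : 'I_m -> R,
    [/\ forall i, [/\ a <= u i, u i <= v i & v i <= s],
        trivIset setT (fun i => `]u i, v i[%classic),
        forall i, `]u i, v i[ `<=` U
      & g a - e * (s - a) - \sum_i `|g (v i) - g (u i)| <= g s].

Let descent_left U e : descent U e a.
Proof.
exists 0, (fun=> 0), (fun=> 0); split => [[]//||[]//|].
  by move=> [].
by rewrite big_ord0 subrr mulr0 !subr0.
Qed.

Let descent_slope U e s s' : s <= s' -> - (e * (s' - s)) <= g s' - g s ->
  descent U e s -> descent U e s'.
Proof.
move=> ss' gss' [m [u [v [uv tuv uvU gs]]]]; exists m, u, v; split=> //.
  by move=> i; have [? ? /le_trans->] := uv i.
lra.
Qed.

Let descent_open U e s s' : 0 < e -> a <= s -> s <= s' -> `]s, s'[ `<=` U ->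
  descent U e s -> descent U e s'.
Proof.
move=> e0 as_ ss' sU [m [u [v [uv tuv uvU gs]]]].
pose ext (w : 'I_m -> R) x (i : 'I_m.+1) :=
  if unlift ord0 i is Some j then w j else x.
have ext0 w x : ext w x ord0 = x by rewrite /ext unlift_none.
have extS w x j : ext w x (lift ord0 j) = w j by rewrite /ext liftK.
exists m.+1, (ext u s), (ext v s'); split.
- move=> i; case: (unliftP ord0 i) => [j|] ->; rewrite ?ext0 ?extS//.
  by have [? ? /le_trans->] := uv j.
- have disj j x : x \in `]u j, v j[ -> ~ (x \in `]s, s'[).
    rewrite !in_itv/= => /andP[_ xv] /andP[sx _].
    have [_ _ vs] := uv j.
    by have := lt_le_trans xv vs; rewrite ltNge (ltW sx).
  move=> i j _ _; case: (unliftP ord0 i) => [i'|] ->;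
    case: (unliftP ord0 j) => [j'|] -> //; rewrite ?ext0 ?extS => -[x [xi xj]].
  + by congr lift; apply: tuv => //; exists x.
  + by case: (disj _ _ xi).
  + by case: (disj _ _ xj).
- by move=> i; case: (unliftP ord0 i) => [j|] ->; rewrite ?ext0 ?extS.
- rewrite big_ord_recl ext0 ext0; under eq_bigr do rewrite !extS.
  have : 0 <= e * (s' - s) by rewrite mulr_ge0 ?subr_ge0// ltW.
  have : g s - g s' <= `|g s' - g s| by rewrite distrC ler_norm.
  lra.
Qed.

(** The supremum of the points reached by [descent] is passed by one more step as
    long as it is below b. *)
Let descent_everywhere U e : 0 < e ->
  (forall s, a <= s <= b -> exists2 d : R, 0 < d & forall u v, a <= u ->
    u <= s <= v -> s - d < u -> v < s + d ->
    - (e * (v - u)) <= g v - g u \/ `]u, v[ `<=` U) -> descent U e b.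
Proof.
move=> e0 loc; pose S := [set s | a <= s <= b /\ descent U e s].
have Sa : S a by split; [rewrite lexx ab|exact: descent_left].
have supS : has_sup S.
  by split; [exists a|exists b => s [/andP[]]].
have ac : a <= sup S by apply: sup_upper_bound.
have cb : sup S <= b by apply: ge_sup; [exists a|move=> s [/andP[]]].
have [d d0 dP] := loc _ (introT andP (conj ac cb)).
have [s [/andP[as_ sb] Ss] cs] := sup_adherent d0 supS.
have sc : s <= sup S by apply: sup_upper_bound => //; split; rewrite ?as_.
have Ss' s' : sup S <= s' -> s' < sup S + d -> descent U e s'.
  move=> cs' s'd; have ss' := le_trans sc cs'.
  have [|H|H] := dP s s' as_ _ cs s'd; first by rewrite sc.
    exact: descent_slope H Ss.
  exact: descent_open H Ss.
have [bd|bd] := ltP b (sup S + d); first exact: Ss'.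
have : sup S + d / 2 <= sup S.
  apply: sup_upper_bound => //; split; last first.
    apply: Ss'; first by rewrite lerDl divr_ge0 ?ltW.
    by rewrite ltrD2l ltr_pdivrMr ?mulr_natr ?mulr2n ?ltrDl.
  by apply/andP; split; lra.
lra.
Qed.

(** Where the derivative exists and is nonnegative, slopes are almost nonnegative.
    The remaining null set lies in an open set U of small measure, over which
    absolute continuity bounds the variation. *)
Lemma abs_cont_ndecr : abs_cont a b g ->
  {ae (@lebesgue_measure R), forall s, s \in `[a, b] ->
     derivable g s 1 /\ 0 <= derive1 g s} -> g a <= g b.
Proof.
move=> acg [N [mN N0 PN]].
suff H e : 0 < e -> g a - e * (b - a + 1) <= g b.
  apply/ler_addgt0Pr => e e0.
  have c0 : 0 < b - a + 1 by move: ab; lra.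
  have := H _ (divr_gt0 e0 c0); rewrite divfK ?gt_eqF//; lra.
move=> e0; have [d d0 dP] := acg e e0.
have [|U [oU NU UN]] := lebesgue_regularity_outer mN _ d0.
  by move: N0 => /= ->.
have mU : measurable U by exact: measurable_realfun.open_measurable.
have Ud : (lebesgue_measure U < d%:E)%E.
  have := measureU2 (@lebesgue_measure R) (measurableD mU mN) mN.
  rewrite setUC setDUK// => /le_lt_trans; apply.
  by move: N0 => /= ->; rewrite adde0.
have /(_ e0)[|m [u [v [uv tuv uvU gb]]]] := @descent_everywhere U e.
  move=> s /andP[as_ sb]; have [Ns|Ns] := pselect (N s).
    have /nbhs_ballP[r /= r0 rU] : nbhs s U by apply: open_nbhs_nbhs; split=> //; exact: NU.
    exists r => // u v _ /andP[us sv] ru rv; right => x /=.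
    rewrite in_itv/= => /andP[ux xv]; apply: rU.
    by rewrite /ball/= ltr_distlC; apply/andP; split; lra.
  have [gs gs0] : derivable g s 1 /\ 0 <= derive1 g s.
    by apply: contrapT => H; apply: Ns; apply: PN => /= /(_ _); rewrite in_itv/= as_ sb => /(_ isT).
  have [r r0 rP] := derivable_slope_ge gs gs0 e0.
  by exists r => // u v _ usv su vs; left; exact: rP.
have := dP m u v uv tuv; have /[swap]/[apply] : \sum_i (v i - u i) < d.
  by apply: sum_itv_lt_of_measure Ud => // i; have [] := uv i.
lra.
Qed.

End monotone.
End abs_cont.

(** * Clamping to an interval *)

Section clamp.
Context {R : realType}.
Implicit Types a b s t : R.

Definition clamp a b s := Num.max a (Num.min s b).

Lemma clamp_itv a b s : a <= b -> a <= clamp a b s <= b.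
Proof. by move=> ab; rewrite /clamp le_max lexx ge_max ab ge_min lexx orbT. Qed.

Lemma clamp_id a b s : a <= s <= b -> clamp a b s = s.
Proof. by move=> /andP[as_ sb]; rewrite /clamp min_l// max_r. Qed.

Lemma clamp_ndecr a b s t : s <= t -> clamp a b s <= clamp a b t.
Proof.
move=> st; rewrite /clamp ge_max le_max lexx/= le_max; apply/orP; right.
by rewrite le_min !ge_min st lexx orbT.
Qed.

Lemma clamp_dist a b s t : s <= t -> clamp a b t - clamp a b s <= t - s.
Proof.
move=> st; rewrite /clamp /Num.max /Num.min.
case: (ltP s b); case: (ltP t b) => ? ?;
  by repeat (case: ltP => ?); lra.
Qed.

Lemma clamp_lip a b s t : `|clamp a b t - clamp a b s| <= `|t - s|.
Proof.
wlog st : s t / s <= t => [H|].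
  by have [/H//|/ltW/H] := leP s t; rewrite distrC (distrC s).
by rewrite !ger0_norm ?subr_ge0 ?clamp_ndecr// clamp_dist.
Qed.

Lemma clamp_norm r s : 0 <= r -> `|clamp (- r) r s| <= `|s|.
Proof.
move=> r0; have := clamp_lip (- r) r 0 s; rewrite (clamp_id (s := 0)) ?subr0//.
by rewrite r0 andbT; lra.
Qed.

End clamp.

(** * Calculus and Gronwall's inequality for absolutely continuous functions *)

Section abs_cont_theory.
Context {R : realType}.
Implicit Types (a b : R) (f g : R -> R).

Lemma abs_contD a b f g : abs_cont a b f -> abs_cont a b g ->
  abs_cont a b (fun s => f s + g s).
Proof.
move=> acf acg e e0; have e2 : 0 < e / 2 by rewrite divr_gt0.
have [d d0 dP] := acf _ e2; have [d' d'0 d'P] := acg _ e2.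
exists (Num.min d d'); first by rewrite lt_min d0.
move=> m u v uv tuv; rewrite lt_min => /andP[ud ud'].
have := dP m u v uv tuv ud; have := d'P m u v uv tuv ud'.
suff : \sum_i `|f (v i) + g (v i) - (f (u i) + g (u i))| <=
  \sum_i `|f (v i) - f (u i)| + \sum_i `|g (v i) - g (u i)| by lra.
rewrite -big_split/=; apply: ler_sum => i _.
by rewrite opprD addrACA ler_normD.
Qed.

Lemma abs_cont_lip a b g (L : R) :
  (forall s t, a <= s -> s <= t -> t <= b -> `|g t - g s| <= L * (t - s)) ->
  abs_cont a b g.
Proof.
move=> gL e e0; exists (e / (`|L| + 1)).
  by rewrite divr_gt0// ltr_pwDr.
move=> m u v uv _; rewrite ltr_pdivlMr ?ltr_pwDr//; apply: le_lt_trans.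
rewrite mulr_suml; apply: ler_sum => i _; have [ua uvi vb] := uv i.
apply: le_trans (gL _ _ _ _ _) _ => //; rewrite mulrC ler_wpM2l ?subr_ge0//.
by rewrite (le_trans (ler_norm _))// lerDl.
Qed.

Lemma abs_cont_clamp_continuous a b g : a <= b -> abs_cont a b g ->
  continuous (fun s => g (clamp a b s)).
Proof.
move=> ab acg s; apply/cvgrPdist_lt => e e0.
have [d d0 dP] := acg e e0; apply/nbhs_ballP; exists d => //= t.
rewrite /ball/= => std.
have H u v : a <= u -> u <= v -> v <= b -> v - u < d -> `|g v - g u| < e.
  move=> au uv vb vud; have := dP 1 (fun=> u) (fun=> v).
  rewrite !big_ord1; apply=> //.
  by move=> i j _ _ _; rewrite !ord1.
have /andP[as_ sb] := clamp_itv s ab; have /andP[at_ tb] := clamp_itv t ab.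
have := le_lt_trans (clamp_lip a b t s) std.
have [st|ts] := leP (clamp a b s) (clamp a b t).
  by rewrite ler0_norm ?subr_le0// opprB distrC => /(H _ _ as_ st tb).
by rewrite gtr0_norm ?subr_gt0// => /(H _ _ at_ (ltW ts) sb).
Qed.

Lemma abs_cont_bounded a b g : a <= b -> abs_cont a b g ->
  exists2 B : R, 0 <= B & forall s, a <= s <= b -> `|g s| <= B.
Proof.
move=> ab acg; have gc := abs_cont_clamp_continuous ab acg.
have gnc : {within `[a, b], continuous (fun s => `|g (clamp a b s)|)}.
  apply: continuous_subspaceT => s.
  exact: cvg_norm (gc s).
have [c _ cP] := EVT_max ab gnc.
exists `|g (clamp a b c)| => // s sab.
by have := cP s; rewrite in_itv/= sab (clamp_id sab); apply.
Qed.

Lemma abs_contM a b f g : a <= b -> abs_cont a b f -> abs_cont a b g ->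
  abs_cont a b (fun s => f s * g s).
Proof.
move=> ab acf acg e e0.
have [B B0 fB] := abs_cont_bounded ab acf.
have [C C0 gC] := abs_cont_bounded ab acg.
have [|d d0 dP] := acf (e / 2 / (C + 1)).
  by rewrite !divr_gt0// ltr_wpDl.
have [|d' d'0 d'P] := acg (e / 2 / (B + 1)).
  by rewrite !divr_gt0// ltr_wpDl.
exists (Num.min d d'); first by rewrite lt_min d0.
move=> m u v uv tuv; rewrite lt_min => /andP[ud ud'].
have := dP m u v uv tuv ud; have := d'P m u v uv tuv ud'.
rewrite !ltr_pdivlMr ?ltr_wpDl//.
suff : \sum_i `|f (v i) * g (v i) - f (u i) * g (u i)| <=
  (\sum_i `|f (v i) - f (u i)|) * (C + 1)
   + (\sum_i `|g (v i) - g (u i)|) * (B + 1) by lra.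
rewrite !mulr_suml -big_split/=; apply: ler_sum => i _.
have [au uvi vb] := uv i.
have -> : f (v i) * g (v i) - f (u i) * g (u i) =
  (f (v i) - f (u i)) * g (v i) + (g (v i) - g (u i)) * f (u i) by ring.
apply: le_trans (ler_normD _ _) _; rewrite !normrM lerD// ler_wpM2l//.
  by apply: le_trans (gC _ _) _; rewrite ?lerDl// vb (le_trans au uvi).
by apply: le_trans (fB _ _) _; rewrite ?lerDl// au (le_trans uvi vb).
Qed.

Lemma abs_cont_cst a b (c : R) : abs_cont a b (fun=> c).
Proof. by apply: (@abs_cont_lip _ _ _ 0) => *; rewrite subrr normr0 mul0r. Qed.

Lemma abs_contN a b g : a <= b -> abs_cont a b g -> abs_cont a b (fun s => - g s).
Proof.
move=> ab acg; have := abs_contM ab (@abs_cont_cst a b (-1)) acg.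
by congr abs_cont; apply/funext => s; rewrite mulN1r.
Qed.

Lemma abs_cont_sum (I : Type) (r : seq I) a b (g : I -> R -> R) :
  (forall i, abs_cont a b (g i)) -> abs_cont a b (fun s => \sum_(i <- r) g i s).
Proof.
move=> acg; elim: r => [|i r IH].
  rewrite (_ : (fun _ => _) = fun=> 0); first exact: abs_cont_cst.
  by apply/funext => s; rewrite big_nil.
rewrite (_ : (fun _ => _) = fun s => g i s + \sum_(j <- r) g j s).
  exact: abs_contD.
by apply/funext => s; rewrite big_cons.
Qed.

Lemma derive_bound_lip (f f' : R -> R) (a b L : R) :
  (forall s, a <= s <= b -> is_derive s 1 f (f' s)) ->
  (forall s, a <= s <= b -> `|f' s| <= L) ->
  forall s t, a <= s -> s <= t -> t <= b -> `|f t - f s| <= L * (t - s).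
Proof.
move=> ff' f'L s t as_ st tb.
have sub x : s <= x <= t -> a <= x <= b.
  by move=> /andP[sx xt]; rewrite (le_trans as_ sx) (le_trans xt tb).
have [x|x|c] := @MVT_segment _ f f' s t st.
- by rewrite in_itv/= => /andP[sx xt]; apply: ff'; apply: sub; rewrite !ltW.
- apply: derivable_within_continuous => y; rewrite in_itv/= => yst.
  by have := ff' _ (sub _ yst).
rewrite in_itv/= => cst ->; rewrite normrM (ger0_norm (_ : 0 <= t - s)) ?subr_ge0//.
by rewrite ler_wpM2r ?subr_ge0// f'L// sub.
Qed.

Lemma is_derive_expRM (k s : R) :
  is_derive s 1 (fun t => expR (k * t)) (k * expR (k * s)).
Proof.
have H : is_derive s (1 : R) (fun t : R => k * t) (k *: 1).
  by apply: is_deriveZ.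
have := @is_derive1_comp R expR (fun t => k * t) s _ _ (is_derive_expR _) H.
by rewrite /GRing.scale/= mulr1 mulrC.
Qed.

Lemma abs_cont_expRM a b (k : R) : abs_cont a b (fun t => expR (k * t)).
Proof.
have [ab|ba] := leP a b; last first.
  apply: (@abs_cont_lip _ _ _ 0) => s t as_ st tb.
  by have := le_lt_trans (le_trans as_ (le_trans st tb)) ba; rewrite ltxx.
apply: (@abs_cont_lip _ _ _ (`|k| * expR (`|k| * (`|a| + `|b|)))).
apply: (@derive_bound_lip _ (fun s => k * expR (k * s))) => s sab.
  exact: is_derive_expRM.
rewrite normrM ler_wpM2l// ger0_norm ?expR_ge0// ler_expR.
rewrite (le_trans (ler_norm _))// normrM ler_wpM2l//.
have := ler_norm b; have := ler_norm (- a); rewrite normrN.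
have := normr_ge0 a; have := normr_ge0 b.
by case/andP: sab; case: (ler0P s); lra.
Qed.

Lemma ae_imp (P Q : R -> Prop) : (forall s, P s -> Q s) ->
  {ae (@lebesgue_measure R), forall s, P s} ->
  {ae (@lebesgue_measure R), forall s, Q s}.
Proof. by move=> PQ; apply: (@filterS _ _ (ae_filter_ringOfSetsType _)). Qed.

Lemma ae_imp2 (P Q S : R -> Prop) : (forall s, P s -> Q s -> S s) ->
  {ae (@lebesgue_measure R), forall s, P s} ->
  {ae (@lebesgue_measure R), forall s, Q s} ->
  {ae (@lebesgue_measure R), forall s, S s}.
Proof. by move=> PQ; apply: (@filterS2 _ _ (ae_filter_ringOfSetsType _)). Qed.

Lemma ae_neq (c : R) : {ae (@lebesgue_measure R), forall s, s != c}.
Proof.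
exists [set c]; split; [exact: measurable_set1|exact: lebesgue_measure_set1|].
by move=> s /= /negP; rewrite negbK => /eqP.
Qed.

(** The function exp (- k s) g s has a nonnegative derivative almost everywhere. *)
Lemma gronwall a b (k : R) g : a <= b -> abs_cont a b g ->
  {ae (@lebesgue_measure R), forall s, s \in `[a, b] ->
     exists2 g', is_derive s 1 g g' & k * g s <= g'} ->
  expR (k * (b - a)) * g a <= g b.
Proof.
move=> ab acg aeg; pose h s := expR (- k * s) * g s.
have : h a <= h b.
  apply: abs_cont_ndecr => //.
    by apply: abs_contM => //; exact: abs_cont_expRM.
  apply: ae_imp aeg => s H sab; have [g' gg' kg] := H sab.
  have hd := is_deriveM (is_derive_expRM (- k) s) gg'.
  split; first by have := hd.
  rewrite derive1E /h derive_val /GRing.scale/=.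
  have := expR_ge0 (- k * s); set E := expR _ => E0.
  have -> : E * g' + g s * (- k * E) = E * (g' - k * g s) by ring.
  by rewrite mulr_ge0// subr_ge0.
rewrite /h -(ler_pM2l (expR_gt0 (k * b))) !mulrA -!expRD.
rewrite (_ : k * b + - k * a = k * (b - a)); last by ring.
by rewrite (_ : k * b + - k * b = 0) ?expR0 ?mul1r//; ring.
Qed.

End abs_cont_theory.

(** * Arcs *)

Lemma is_derive_subst (R : realType) (V : normedModType R) (y : R -> V) (s : R) d d' :
  is_derive s (1 : R) y d -> d = d' -> is_derive s (1 : R) y d'.
Proof. by move=> + <-. Qed.

Section arcs.
Context {R : realType} {n : nat}.
Implicit Types (a b c s t : R) (x v : 'rV[R]_n) (f g y z : R -> 'rV[R]_n).

Lemma is_derive_coord y s v i : is_derive s (1 : R) y v ->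
  is_derive s (1 : R) (fun t => y t 0 i) (v 0 i).
Proof.
move=> yv; have dy : derivable y s 1 by [].
apply: DeriveDef; first by have /derivable_mxP := dy; apply.
by have := derive_mx dy; rewrite derive_val => ->; rewrite mxE.
Qed.

Lemma is_derive_rowP y s v :
  (forall i, is_derive s (1 : R) (fun t => y t 0 i) (v 0 i)) ->
  is_derive s (1 : R) y v.
Proof.
move=> yv; have dy : derivable y s 1.
  by apply/derivable_mxP => i j; rewrite ord1; have := yv j.
apply: DeriveDef => //; rewrite derive_mx//; apply/rowP => i.
by rewrite mxE; have := yv i => ?; rewrite derive_val.
Qed.

Lemma is_derive_dot f g s (f' g' : 'rV[R]_n) : is_derive s (1 : R) f f' ->
  is_derive s (1 : R) g g' ->
  is_derive s (1 : R) (fun t => dot (f t) (g t)) (dot f' (g s) + dot (f s) g').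
Proof.
move=> ff' gg'; rewrite /dot -big_split/=.
rewrite (_ : (fun t => _) = \sum_i (fun t => f t 0 i * g t 0 i)); last first.
  by apply/funext => t; rewrite fct_sumE.
apply: is_derive_sum => i.
apply: is_derive_subst.
  exact: is_deriveM (is_derive_coord i ff') (is_derive_coord i gg').
by rewrite /GRing.scale/= [RHS]addrC; congr (_ + _); rewrite mulrC.
Qed.

Lemma is_arc_coord a b y i : is_arc a b y -> abs_cont a b (fun s => y s 0 i).
Proof.
move=> ay e e0; have [d d0 dP] := ay e e0; exists d => // m u v uv tuv uvd.
apply: le_lt_trans (dP m u v uv tuv uvd); apply: ler_sum => j _.
by apply: le_trans (coord_le_enorm _ i); rewrite !mxE.
Qed.

Lemma is_arc_sub a b a' b' y : a <= a' -> b' <= b ->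
  is_arc a b y -> is_arc a' b' y.
Proof.
move=> aa bb acg e e0; have [d d0 dP] := acg e e0; exists d => // m u v uv.
by apply: dP => i; have [? ? ?] := uv i; split=> //;
  [exact: le_trans aa _|exact: le_trans bb].
Qed.

Lemma is_arcD a b y z : is_arc a b y -> is_arc a b z ->
  is_arc a b (fun s => y s + z s).
Proof.
move=> acf acg e e0; have e2 : 0 < e / 2 by rewrite divr_gt0.
have [d d0 dP] := acf _ e2; have [d' d'0 d'P] := acg _ e2.
exists (Num.min d d'); first by rewrite lt_min d0.
move=> m u v uv tuv; rewrite lt_min => /andP[ud ud'].
have := dP m u v uv tuv ud; have := d'P m u v uv tuv ud'.
suff : \sum_i enorm (y (v i) + z (v i) - (y (u i) + z (u i))) <=
  \sum_i enorm (y (v i) - y (u i)) + \sum_i enorm (z (v i) - z (u i)) by lra.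
rewrite -big_split/=; apply: ler_sum => i _.
by rewrite opprD addrACA enormD.
Qed.

Lemma is_arcN a b y : is_arc a b y -> is_arc a b (fun s => - y s).
Proof.
move=> ay e e0; have [d d0 dP] := ay e e0; exists d => // m u v uv tuv uvd.
have := dP m u v uv tuv uvd; congr (_ < _); apply: eq_bigr => i _.
by rewrite -opprD enormN.
Qed.

Lemma is_arcB a b y z : is_arc a b y -> is_arc a b z ->
  is_arc a b (fun s => y s - z s).
Proof. by move=> ay /is_arcN; exact: is_arcD. Qed.

Lemma is_arc_lip a b y (L : R) :
  (forall s t, a <= s -> s <= t -> t <= b -> enorm (y t - y s) <= L * (t - s)) ->
  is_arc a b y.
Proof.
move=> gL e e0; exists (e / (`|L| + 1)).
  by rewrite divr_gt0// ltr_pwDr.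
move=> m u v uv _; rewrite ltr_pdivlMr ?ltr_pwDr//; apply: le_lt_trans.
rewrite mulr_suml; apply: ler_sum => i _; have [ua uvi vb] := uv i.
apply: le_trans (gL _ _ _ _ _) _ => //; rewrite mulrC ler_wpM2l ?subr_ge0//.
by rewrite (le_trans (ler_norm _))// lerDl.
Qed.

(** Clamping sends disjoint intervals to disjoint intervals and does not lengthen
    them. *)
Lemma is_arc_clamp a b a' b' y : a <= b -> is_arc a b y ->
  is_arc a' b' (fun s => y (clamp a b s)).
Proof.
move=> ab ay e e0; have [d d0 dP] := ay e e0; exists d => // m u v uv tuv uvd.
apply: (dP m (fun i => clamp a b (u i)) (fun i => clamp a b (v i))).
- move=> i; have /andP[? _] := clamp_itv (u i) ab.
  have /andP[_ ?] := clamp_itv (v i) ab.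
  by have [_ uvi _] := uv i; split=> //; exact: clamp_ndecr.
- move=> i j _ _ [s /= [si sj]]; apply: tuv => //; exists s.
  have sub k : s \in `]clamp a b (u k), clamp a b (v k)[ -> s \in `]u k, v k[.
    rewrite !in_itv/= /clamp gt_max lt_max gt_min => /andP[/andP[as_ +] +].
    rewrite (lt_gtF as_)/= lt_min => /orP[->|bs] /andP[-> //].
    by rewrite (lt_gtF bs).
  by split; exact: sub.
- apply: le_lt_trans uvd; apply: ler_sum => i _; apply: clamp_dist.
  by have [] := uv i.
Qed.

(** The concatenation is, up to the constant z c, the sum of two clamped arcs, so
    that no interval of a family has to be cut at c. *)
Lemma is_arc_cat a b c y z : a <= c -> c <= b -> is_arc a c y -> is_arc c b z ->
  y c = z c -> is_arc a b (fun s => if s <= c then y s else z s).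
Proof.
move=> ac cb ay az yzc.
have H := is_arcD (is_arc_clamp a b ac ay) (is_arc_clamp a b cb az).
move=> e e0; have [d d0 dP] := H e e0; exists d => // m u v uv tuv uvd.
have := dP m u v uv tuv uvd; congr (_ < _); apply: eq_bigr => i _.
have E s : a <= s -> s <= b -> y (clamp a c s) + z (clamp c b s) =
    (if s <= c then y s else z s) + z c.
  move=> as_ sb; case: ifPn => [sc|]; last rewrite -ltNge => cs.
    rewrite clamp_id ?as_//; congr (_ + z _).
    by rewrite /clamp min_l// max_l.
  rewrite (clamp_id (a := c)) ?sb ?ltW// addrC; congr (_ + _); rewrite -yzc.
  by congr y; rewrite /clamp min_r ?max_r// ltW.
have [au uvi vb] := uv i.
rewrite /= (E (v i)) ?(E (u i)) ?(le_trans au uvi)// ?(le_trans uvi vb)//.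
by rewrite opprD addrACA subrr addr0.
Qed.

Lemma abs_cont_dot a b f g : a <= b -> is_arc a b f -> is_arc a b g ->
  abs_cont a b (fun s => dot (f s) (g s)).
Proof.
move=> ab af ag; apply: abs_cont_sum => i.
by apply: abs_contM => //; exact: is_arc_coord.
Qed.

Lemma is_arc_cst a b v : is_arc a b (fun=> v).
Proof.
by apply: (@is_arc_lip _ _ _ 0) => s t _ _ _; rewrite subrr enorm0 mul0r.
Qed.

Lemma is_derive_dotr y s v x : is_derive s (1 : R) y v ->
  is_derive s (1 : R) (fun t => dot (y t) x) (dot v x).
Proof.
move=> yv; apply: is_derive_subst.
  exact: is_derive_dot yv (is_derive_cst x s (1 : R)).
by rewrite dot0r addr0.
Qed.

(** Monotonicity applied to the scalar function K s - dot (y s) x. *)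
Lemma arc_increment_le a b y x (K : R) : a <= b -> is_arc a b y ->
  {ae (@lebesgue_measure R), forall s, s \in `[a, b] ->
     exists2 v, is_derive s (1 : R) y v & dot v x <= K} ->
  dot (y b - y a) x <= K * (b - a).
Proof.
move=> ab ay aey; rewrite dotBl.
suff : K * a - dot (y a) x <= K * b - dot (y b) x by lra.
apply: (@abs_cont_ndecr _ _ _ (fun s => K * s - dot (y s) x)) => //.
  apply: abs_contD; first apply: abs_contM => //; first exact: abs_cont_cst.
    by apply: (@abs_cont_lip _ _ _ _ 1) => s t _ st _; rewrite ger0_norm ?subr_ge0// mul1r.
  by apply: abs_contN => //; apply: abs_cont_dot => //; exact: is_arc_cst.
apply: ae_imp aey => s H sab; have [v yv vK] := H sab.
have hd : is_derive s (1 : R) (fun s => K * s - dot (y s) x) (K - dot v x).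
  have h1 : is_derive s (1 : R) (fun t : R => K * t) (K *: 1).
    by apply: is_deriveZ.
  apply: is_derive_subst; first exact: is_deriveB h1 (is_derive_dotr x yv).
  by rewrite /GRing.scale/= mulr1.
by split=> //; rewrite derive1E derive_val subr_ge0.
Qed.

(** The increment is paired with itself, which reduces the bound to a scalar one. *)
Lemma arc_lip a b y (L : R) : 0 <= L -> is_arc a b y ->
  {ae (@lebesgue_measure R), forall s, s \in `[a, b] ->
     exists2 v, is_derive s (1 : R) y v & enorm v <= L} ->
  forall s t, a <= s -> s <= t -> t <= b -> enorm (y t - y s) <= L * (t - s).
Proof.
move=> L0 ay aey s t as_ st tb; set u := y t - y s.
have [->|u0] := eqVneq u 0; first by rewrite enorm0 mulr_ge0// subr_ge0.
rewrite -enorm_gt0 in u0; rewrite -(ler_pM2r u0) -expr2 sqr_enorm.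
rewrite mulrAC; apply: arc_increment_le => //; first exact: is_arc_sub ay.
apply: ae_imp aey => r H; rewrite in_itv/= => /andP[sr rt].
have [|v yv vL] := H; first by rewrite in_itv/= (le_trans as_ sr) (le_trans rt tb).
by exists v => //; rewrite (le_trans (dot_le _ _))// ler_wpM2r// ltW.
Qed.

Lemma derive_lip a b y (y' : R -> 'rV[R]_n) (L : R) :
  (forall s, a <= s <= b -> is_derive s (1 : R) y (y' s)) ->
  (forall s, a <= s <= b -> enorm (y' s) <= L) ->
  forall s t, a <= s -> s <= t -> t <= b -> enorm (y t - y s) <= L * (t - s).
Proof.
move=> yy' y'L s t as_ st tb; set u := y t - y s.
have L0 : 0 <= L.
  by rewrite (le_trans _ (y'L s _)) ?enorm_ge0// as_ (le_trans st).
have [->|u0] := eqVneq u 0; first by rewrite enorm0 mulr_ge0// subr_ge0.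
rewrite -enorm_gt0 in u0; rewrite -(ler_pM2r u0) -expr2 sqr_enorm {1}/u dotBl.
rewrite mulrAC (le_trans (ler_norm _))//.
apply: (@derive_bound_lip _ (fun r => dot (y r) u) (fun r => dot (y' r) u) a b) => // r rab.
  by apply: is_derive_dotr; exact: yy'.
rewrite (le_trans (dot_le_enorm _ _))// ler_wpM2r ?y'L//.
exact: enorm_ge0.
Qed.

End arcs.

(** * Antiderivatives and geometric convergence *)

Section antiderivative.
Context {R : realType}.
Implicit Types (u U : R -> R).

Lemma derive_eq_increment (f g f' : R -> R) (a b : R) : a <= b ->
  (forall s, a <= s <= b -> is_derive s (1 : R) f (f' s)) ->
  (forall s, a <= s <= b -> is_derive s (1 : R) g (f' s)) ->
  f b - f a = g b - g a.
Proof.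
move=> ab ff' gf'; apply/eqP; rewrite -subr_eq0 -normr_le0.
have := @derive_bound_lip _ (fun s => f s - g s) (fun=> 0) a b 0.
move=> /(_ _ _ a b (lexx _) ab (lexx _)); rewrite mul0r => H.
rewrite (_ : _ - _ = f b - g b - (f a - g a)); last by ring.
apply: H => s sab; last by rewrite normr0.
apply: (is_derive_subst (is_deriveB (ff' _ sab) (gf' _ sab))).
by rewrite subrr.
Qed.

Lemma continuous_antiderivative_right u (N : R) : continuous u ->
  exists U, forall s, - N < s -> is_derive s (1 : R) U (u s).
Proof.
move=> cu; exists (fun s => \int[lebesgue_measure]_(t in `[- N, s]) u t)%R => s Ns.
have iu : lebesgue_measure.-integrable `[- N, s + 1] (EFin \o u).
  apply: continuous_compact_integrable; first exact: segment_compact.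
  exact: continuous_subspaceT.
have s1 : s < s + 1 by rewrite ltrDl.
have [dU Us] := continuous_FTC1_closed s1 iu Ns (cu s).
by apply: DeriveDef => //; rewrite -derive1E.
Qed.

(** Integrals over [- N, s] are antiderivatives only for s > - N; since two
    antiderivatives have the same increments, letting N depend on the point
    yields one on the whole line. *)
Lemma continuous_antiderivative u (c : R) : continuous u ->
  exists2 U, U c = 0 & forall s, is_derive s (1 : R) U (u s).
Proof.
move=> cu; have [F FP] := choice (fun N => continuous_antiderivative_right N cu).
have agree N N' r s : - N < r -> - N' < r -> - N < s -> - N' < s ->
    F N s - F N r = F N' s - F N' r.
  wlog rs : r s / r <= s => [H|Nr N'r Ns N's].
    have [rs|/ltW sr] := leP r s; first exact: H.
    move=> *; apply: oppr_inj; rewrite !opprB; exact: H.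
  by apply: (derive_eq_increment rs) => t /andP[rt _]; apply: FP;
    rewrite (lt_le_trans _ rt).
pose W (s : R) : R := `|s| + `|c| + 1.
have Wl (s : R) : - W s < s.
  by rewrite /W; have := ler_norm (- s); rewrite normrN; have := normr_ge0 c; lra.
have Wc (s : R) : - W s < c.
  by rewrite /W; have := ler_norm (- c); rewrite normrN; have := normr_ge0 s; lra.
exists (fun s => F (W s) s - F (W s) c); first by rewrite subrr.
move=> s; apply: (@near_eq_is_derive _ _ _ (fun r => F (W s + 1) r - F (W s + 1) c)).
  apply/nbhs_ballP; exists 1 => //= r; rewrite /ball/= ltr_distlC => /andP[sr rs].
  by apply: agree => //; have := Wl s; have := Wc s; lra.
have Ws : - (W s + 1) < s by have := Wl s; lra.
apply: (is_derive_subst (is_deriveB (FP _ _ Ws) (is_derive_cst _ _ _))).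
by rewrite subr0.
Qed.

Lemma is_derive_opp (g : R -> R) (s d : R) : is_derive (- s) (1 : R) g d ->
  is_derive s (1 : R) (fun r => g (- r)) (- d).
Proof.
move=> gd; have H : is_derive s (1 : R) (fun r : R => - r) (- 1).
  by apply: is_deriveN.
have := @is_derive1_comp R g (fun r => - r) s _ _ gd H.
by rewrite mulrN1.
Qed.

Let exp_increment_right (g g' : R -> R) (L K c s : R) : 0 < L -> 0 <= K ->
  c <= s -> g c = 0 -> (forall r, is_derive r (1 : R) g (g' r)) ->
  (forall r, g' r <= L * K * expR (L * `|r - c|)) ->
  g s <= K * expR (L * `|s - c|).
Proof.
move=> L0 K0 cs gc0 gg' g'K.
pose h r := K * expR (L * (r - c)) - g r.
have h1 r : is_derive r (1 : R) (fun x => L * (x - c)) L.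
  have h1 : is_derive r (1 : R) (fun x : R => x - c) (1 - 0) by apply: is_deriveB.
  apply: (is_derive_subst ((is_deriveZ L h1))).
  by rewrite /GRing.scale/= subr0 mulr1.
have hd r : is_derive r (1 : R) h (L * K * expR (L * (r - c)) - g' r).
  have h2 := @is_derive1_comp R expR (fun x => L * (x - c)) r _ _ (is_derive_expR _) (h1 r).
  apply: (is_derive_subst (is_deriveB (is_deriveZ K h2) (gg' r))).
  by rewrite /GRing.scale/=; ring.
have hc : {within `[c, s], continuous h}.
  by apply: derivable_within_continuous => y _; have := hd y.
have [r] := @MVT_segment _ h _ c s cs (fun r _ => hd r) hc.
rewrite in_itv/= => /andP[cr rs] hcs.
have : 0 <= h s - h c.
  rewrite hcs mulr_ge0 ?subr_ge0// (le_trans (g'K r))//.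
  by rewrite ger0_norm ?subr_ge0.
rewrite ger0_norm ?subr_ge0// /h gc0 subrr mulr0 expR0; lra.
Qed.

(** The weight exp (L |s - c|) reproduces itself under integration up to the
    factor 1 / L; this is what makes the Picard iteration below contracting on
    the whole line, whatever the Lipschitz constant. *)
Lemma exp_increment (g g' : R -> R) (L K c s : R) : 0 < L -> 0 <= K ->
  g c = 0 -> (forall r, is_derive r (1 : R) g (g' r)) ->
  (forall r, `|g' r| <= L * K * expR (L * `|r - c|)) ->
  `|g s| <= K * expR (L * `|s - c|).
Proof.
move=> L0 K0 gc0 gg' g'K.
have right (f f' : R -> R) (d r : R) : f d = 0 -> (forall r, is_derive r (1 : R) f (f' r)) ->
    (forall r, `|f' r| <= L * K * expR (L * `|r - d|)) -> d <= r ->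
    `|f r| <= K * expR (L * `|r - d|).
  move=> fd0 ff' f'K dr; rewrite ler_norml lerNl; apply/andP; split.
    have nff' q : is_derive q (1 : R) (fun r => - f r) (- f' q).
      exact: is_deriveN (ff' q).
    apply: (exp_increment_right L0 K0 dr _ nff') => [|q].
      by rewrite fd0 oppr0.
    by apply: le_trans (f'K q); rewrite -normrN ler_norm.
  apply: (exp_increment_right L0 K0 dr fd0 ff') => q.
  by apply: le_trans (f'K q); rewrite ler_norm.
have [cs|/ltW sc] := leP c s; first exact: right gg' g'K cs.
have ngg' r : is_derive r (1 : R) (fun q => g (- q)) (- g' (- r)).
  exact: is_derive_opp.
have := right _ _ (- c) (- s) _ ngg'; rewrite !opprK.
have -> : `|s - c| = `|- s + c| by rewrite -normrN opprB addrC.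
apply => //; last by rewrite lerN2.
move=> r; rewrite normrN (le_trans (g'K _))//.
by rewrite -(normrN (- r - c)) opprD !opprK.
Qed.

Lemma half_pow_small (C e : R) : 0 < e -> exists m, C * 2^-1 ^+ m < e.
Proof.
move=> e0; exists (Num.bound `|C / e|); set m := Num.bound _.
have Cm : C / e < m%:R.
  exact: le_lt_trans (ler_norm _) (archimedean.Num.Theory.archi_boundP (normr_ge0 _)).
rewrite exprVn ltr_pdivrMr ?exprn_gt0// mulrC -ltr_pdivrMr//.
by apply: lt_le_trans Cm _; rewrite -natrX ler_nat ltnW// ltn_expl.
Qed.

Lemma le_half_pow (x C : R) : (forall m, x <= C * 2^-1 ^+ m) -> x <= 0.
Proof.
move=> H; rewrite leNgt; apply/negP => x0.
by have [m] := half_pow_small C x0; rewrite ltNge H.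
Qed.

(** The sequences u m - 2 K 2^-m and u m + 2 K 2^-m are monotone and enclose the
    limit. *)
Lemma geometric_limit (u : nat -> R) (K : R) :
  (forall m, `|u m.+1 - u m| <= K * 2^-1 ^+ m) ->
  exists l, forall m, `|u m - l| <= 2 * K * 2^-1 ^+ m.
Proof.
move=> uK; pose r m := 2 * K * (2^-1 : R) ^+ m.
have rS m : r m.+1 = r m - K * 2^-1 ^+ m by rewrite /r exprS; lra.
have lo m k : u m - r m <= u (m + k)%N - r (m + k)%N.
  elim: k => [|k IH]; first by rewrite addn0.
  apply: le_trans IH _; rewrite addnS rS.
  by have := uK (m + k)%N; rewrite ler_norml => /andP[]; lra.
have hi m k : u (m + k)%N + r (m + k)%N <= u m + r m.
  elim: k => [|k IH]; first by rewrite addn0.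
  apply: le_trans IH; rewrite addnS rS.
  by have := uK (m + k)%N; rewrite ler_norml => /andP[]; lra.
have r0 m : 0 <= r m.
  rewrite /r -mulrA mulr_ge0//; exact: le_trans (uK m).
have lohi m k : u m - r m <= u k + r k.
  have := lo m k; have := hi k m; rewrite addnC => h1 h2.
  by have := r0 (m + k)%N; lra.
pose A := [set u m - r m | m in [set: nat]].
have A0 : A !=set0 by exists (u 0 - r 0), 0%N.
exists (sup A) => m; rewrite ler_distl lerBlDr -[X in _ && X]lerBlDr.
apply/andP; split; first by apply: ge_sup => // _ [k _ <-].
by apply: ub_le_sup; [exists (u 0%N + r 0%N) => _ [k _ <-]|exists m].
Qed.

End antiderivative.

(** * The Cauchy-Lipschitz theorem *)

Lemma ex2_conj (T : Type) (A B : T -> Prop) : (exists2 t, A t & B t) ->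
  exists t, A t /\ B t.
Proof. by case=> t; exists t. Qed.

Section picard.
Context {R : realType} {n : nat}.
Variables (f : R -> 'rV[R]_n -> 'rV[R]_n) (c L M : R) (x : 'rV[R]_n).
Hypotheses (L0 : 0 < L) (cf : forall y, continuous (f^~ y)).
Hypothesis fL : forall s y z, `|f s y - f s z| <= L * `|y - z|.
Hypothesis fM : forall s y, `|f s y| <= M.
Implicit Types y z : R -> 'rV[R]_n.

Let continuous_field y : continuous y -> continuous (fun s => f s (y s)).
Proof.
move=> cy s; apply/cvgrPdist_lt => e e0.
have e2 : 0 < e / 2 by rewrite divr_gt0.
have e2L : 0 < e / 2 / L by rewrite divr_gt0.
have /cvgrPdist_lt/(_ _ e2L) := cy s; have /cvgrPdist_lt/(_ _ e2) := @cf (y s) s.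
apply: filterS2 => r fr yr.
rewrite -(subrKA (f r (y s))) (le_lt_trans (ler_normD _ _))//.
rewrite (splitr e) ltrD// (le_lt_trans (fL _ _ _))//.
by rewrite mulrC -ltr_pdivlMr.
Qed.

Let step y : exists z, continuous y ->
  z c = x /\ forall s, is_derive s (1 : R) z (f s (y s)).
Proof.
have [cy|] := pselect (continuous y); last by exists y.
have cyi i : continuous (fun s => f s (y s) 0 i).
  move=> s; apply: (@cvg_comp _ _ _ (fun s => f s (y s)) (fun v : 'rV_n => v 0 i)).
    exact: continuous_field.
  exact: coord_continuous.
have [U UP] := choice (fun i => ex2_conj (continuous_antiderivative c (cyi i))).
exists (fun s => \row_i (x 0 i + U i s)) => _; split.
  by apply/rowP => i; rewrite mxE (UP i).1 addr0.
move=> s; apply: is_derive_rowP => i.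
rewrite (_ : (fun _ => _) = fun t => x 0 i + U i t); last first.
  by apply/funext => t; rewrite mxE.
apply: (is_derive_subst (is_deriveD (is_derive_cst _ _ _) ((UP i).2 s))).
by rewrite add0r.
Qed.

Let derive_continuous y (y' : R -> 'rV[R]_n) :
  (forall s, is_derive s (1 : R) y (y' s)) -> continuous y.
Proof.
move=> yy' s; apply: differentiable_continuous; apply/derivable1_diffP.
by have := yy' s.
Qed.

(** Picard iteration. In the norm weighted by exp (- 2 L |s - c|) each step halves
    distances, so the iterates converge geometrically. The bound M starts the
    iteration, and makes the iterates equi-Lipschitz, so that their limit is
    continuous and can be integrated once more. *)
Theorem picard : exists2 y, y c = x & forall s, is_derive s (1 : R) y (f s (y s)).
Proof.
have [Phi PhiP] := choice step.
pose y m := iter m Phi (fun=> x).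
have M0 : 0 <= M := le_trans (normr_ge0 _) (fM 0 0).
have yS m : continuous (y m) -> y m.+1 c = x /\
    forall s, is_derive s (1 : R) (y m.+1) (f s (y m s)) := @PhiP (y m).
have cy m : continuous (y m).
  elim: m => [s|m /yS[_ /derive_continuous]] //; exact: cvg_cst.
have yc m : y m c = x by case: m => // m; exact: (yS m (cy m)).1.
have dy m s : is_derive s (1 : R) (y m.+1) (f s (y m s)).
  exact: (yS m (cy m)).2 s.
(* Integrating the Lipschitz bound L K w gains the factor 1 / (2 L). *)
pose w (s : R) := expR (2 * L * `|s - c|).
have w0 s : 0 < w s by exact: expR_gt0.
have L20 : 0 < 2 * L by rewrite mulr_gt0.
have halve (g h : R -> 'rV[R]_n) (g' h' : R -> 'rV[R]_n) (K : R) : 0 <= K ->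
    g c = x -> h c = x ->
    (forall s, is_derive s (1 : R) g (g' s)) ->
    (forall s, is_derive s (1 : R) h (h' s)) ->
    (forall s, `|g' s - h' s| <= 2 * L * K * w s) ->
    forall s, `|g s - h s| <= K * w s.
  move=> K0 gc hc gg' hh' ghK s; apply: norm_le_coord => [|i].
    by rewrite mulr_ge0// ltW.
  apply: (@exp_increment _ (fun s => (g s - h s) 0 i) (fun s => (g' s - h' s) 0 i) (2 * L)) => //.
  - by rewrite gc hc subrr mxE.
  - by move=> r; apply: (is_derive_coord (y := fun s => g s - h s)); apply: is_deriveB.
  - by move=> r; rewrite (le_trans (coord_le_norm _ _))// ghK.
pose K := M / (2 * L).
have K0 : 0 <= K by rewrite divr_ge0// ltW.
have half0 m : 0 <= (2^-1 : R) ^+ m by rewrite exprn_ge0// invr_ge0.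
have yK m s : `|y m.+1 s - y m s| <= K * 2^-1 ^+ m * w s.
  elim: m s => [s|m IH s].
    have dy0 (r : R) : is_derive r (1 : R) (y 0%N) (0 : 'rV_n) := is_derive_cst x r 1.
    rewrite mulr1; apply: (halve _ _ _ _ _ K0 (yc 1%N) (yc 0%N) (dy 0%N) dy0) => r.
    rewrite subr0 [2 * L * K]mulrC /K divfK ?gt_eqF//.
    rewrite (le_trans (fM _ _))// ler_peMr//.
    by rewrite -expR0 ler_expR mulr_ge0// ltW.
  have K2 : 0 <= K * 2^-1 ^+ m.+1 by rewrite mulr_ge0.
  apply: (halve _ _ _ _ _ K2 (yc m.+2) (yc m.+1) (dy m.+1) (dy m)) => r.
  rewrite (le_trans (fL _ _ _))// exprS.
  have := IH r; rewrite -(ler_pM2l L0) => /le_trans; apply.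
  by rewrite le_eqVlt; apply/orP; left; apply/eqP; field.
have [l lP] : exists l : R -> 'rV[R]_n, forall m s,
    `|y m s - l s| <= 2 * K * w s * 2^-1 ^+ m.
  have H s i : exists l, forall m, `|y m s 0 i - l| <= 2 * (K * w s) * 2^-1 ^+ m.
    apply: geometric_limit => m; rewrite mulrAC (le_trans _ (yK m s))//.
    by apply: le_trans (coord_le_norm _ i); rewrite !mxE.
  have [l lP] := choice (fun q : R * 'I_n => H q.1 q.2).
  exists (fun s => \row_i l (s, i)) => m s; apply: norm_le_coord => [|i].
    by rewrite mulr_ge0// mulr_ge0 ?(ltW (w0 _))// mulr_ge0.
  by rewrite !mxE -(mulrA 2) (lP (s, i)).
have cl : continuous l.
  have lip s r : s <= r -> `|l r - l s| <= M * (r - s).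
    move=> sr; rewrite -subr_le0.
    apply: (@le_half_pow _ _ (K * w r + K * w s)) => m.
    have ylip : `|y m.+1 r - y m.+1 s| <= M * (r - s).
      apply: norm_le_coord => [|i]; first by rewrite mulr_ge0 ?subr_ge0.
      rewrite !mxE; apply: (@derive_bound_lip _ (fun s => y m.+1 s 0 i)
        (fun s => f s (y m s) 0 i) s r) => // q _.
        exact: is_derive_coord.
      exact: le_trans (coord_le_norm _ _) (fM _ _).
    have := lP m.+1 r; have := lP m.+1 s; rewrite exprS (distrC _ (l r)) => h1 h2.
    have h3 := ler_normD (l r - y m.+1 r) (y m.+1 r - l s).
    have h4 := ler_normD (y m.+1 r - y m.+1 s) (y m.+1 s - l s).
    rewrite !subrKA in h3 h4; move: h1 h2 h3 h4 ylip; set E := 2^-1 ^+ m.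
    have -> q : 2 * K * w q * (2^-1 * E) = K * w q * E by field.
    by lra.
  move=> s; apply/cvgrPdist_lt => e e0.
  have M1 : 0 < M + 1 by rewrite ltr_wpDl.
  apply/nbhs_ballP; exists (e / (M + 1)) => /=; first by rewrite divr_gt0.
  move=> r; rewrite /ball/= ltr_pdivlMr// => sre; apply: le_lt_trans sre.
  have [sr|/ltW rs] := leP s r.
    rewrite distrC (distrC s) (ger0_norm (_ : 0 <= r - s)) ?subr_ge0//.
    by rewrite (le_trans (lip _ _ sr))// mulrC ler_wpM2l ?subr_ge0// lerDl.
  rewrite (ger0_norm (_ : 0 <= s - r)) ?subr_ge0//.
  by rewrite (le_trans (lip _ _ rs))// mulrC ler_wpM2l ?subr_ge0// lerDl.
have [lc dl] := PhiP l cl.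
suff lE : l = Phi l by exists l => [|s]; rewrite {1}lE.
apply/funext => s; apply/eqP; rewrite -subr_eq0 -normr_le0.
apply: (@le_half_pow _ _ (2 * K * w s)) => m.
have : `|y m.+1 s - Phi l s| <= K * 2^-1 ^+ m * w s.
  have K2 : 0 <= K * 2^-1 ^+ m by rewrite mulr_ge0.
  apply: (halve _ _ _ _ _ K2 (yc _) lc (dy _) dl) => r; rewrite (le_trans (fL _ _ _))//.
  have := lP m r; rewrite -(ler_pM2l L0) => /le_trans; apply.
  by rewrite le_eqVlt; apply/orP; left; apply/eqP; ring.
have := lP m.+1 s; rewrite exprS (distrC _ (l s)) => h1 h2.
rewrite -(subrKA (y m.+1 s)) (le_trans (ler_normD _ _))//.
apply: le_trans (lerD h1 h2) _.
by rewrite le_eqVlt; apply/orP; left; apply/eqP; field.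
Qed.
End picard.

(** * Frechet subgradients *)

Section subgradients.
Context {R : realType} {n : nat}.
Implicit Types (f : 'rV[R]_n -> R) (x y p q v : 'rV[R]_n).

Lemma enorm_continuous f :
  (forall v e, 0 < e -> exists2 d : R, 0 < d &
     forall w, enorm (w - v) < d -> `|f v - f w| < e) -> continuous f.
Proof.
move=> fc v; apply: (iffRL (@cvgrPdist_lt _ _ _ _ (nbhs_filter v) _ _)) => e e0.
by apply/near_enormP; have [d d0 dP] := fc v e e0; exists d.
Qed.

Lemma continuous_dot p : continuous (fun v : 'rV[R]_n => dot v p).
Proof.
apply: enorm_continuous => v e e0.
have P0 : 0 < enorm p + 1 by rewrite ltr_wpDl ?enorm_ge0.
exists (e / (enorm p + 1)); first by rewrite divr_gt0.
move=> w; rewrite ltr_pdivlMr// enorm_sym -dotBl; apply: le_lt_trans.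
rewrite (le_trans (dot_le_enorm _ _))// ler_wpM2l ?enorm_ge0//.
by rewrite lerDl.
Qed.

Lemma continuous_enormB x : continuous (fun v : 'rV[R]_n => enorm (v - x)).
Proof.
apply: enorm_continuous => v e e0; exists e => // w; apply: le_lt_trans.
rewrite ler_norml; have := enorm_triangle w v x; have := enorm_triangle v w x.
by rewrite (enorm_sym v w); lra.
Qed.

(** In the directions of the basis vectors and of their opposites, the subgradient
    inequality bounds the difference quotient from both sides. *)
Lemma subgradient_derivable f p q : frechet_subdiff f p q ->
  differentiable f p -> q = gradient f p.
Proof.
move=> /frechet_subdiffP fq df; apply/rowP => i; rewrite mxE.
set D := 'D__ _ _.
have fD : h^-1 *: (f (h *: delta_mx 0 i + p) - f p) @[h --> 0^'] --> D.
  exact: (diff_derivable df).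
have edelta : enorm (delta_mx 0 i : 'rV[R]_n) = 1.
  by rewrite /enorm dot_delta mxE !eqxx sqrtr1.
have quot h e : 0 < e -> - (e * `|h|) <= f (h *: delta_mx 0 i + p) - f p - h * q 0 i ->
    0 <= h * (h^-1 *: (f (h *: delta_mx 0 i + p) - f p) - q 0 i) + e * `|h|.
  have [->|h0] := eqVneq h 0.
    by rewrite scale0r add0r subrr !mul0r normr0 mulr0 addr0.
  move=> e0 H; rewrite mulrBr /GRing.scale/= mulVKf//; lra.
suff H e : 0 < e -> `|D - q 0 i| <= 2 * e.
  apply/esym/eqP; rewrite -subr_eq0 -normr_le0.
  by apply/ler_addgt0Pr => e e0; rewrite add0r (le_trans (H (e / 2) _)) ?divr_gt0//; lra.
move=> e0; have [d d0 dP] := fq e e0.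
move/cvgrPdist_lt/(_ _ e0) : fD => [r /= r0 rP].
pose h := Num.min d r / 2.
have m0 : 0 < Num.min d r by rewrite lt_min d0.
have h0 : 0 < h by rewrite divr_gt0.
have hm : h < Num.min d r by rewrite ltr_pdivrMr// ltr_pMr// ltr1n.
move: hm; rewrite lt_min => /andP[hd hr].
have step (s : R) : `|s| = h ->
    `|D - s^-1 *: (f (s *: delta_mx 0 i + p) - f p)| < e /\
    0 <= s * (s^-1 *: (f (s *: delta_mx 0 i + p) - f p) - q 0 i) + e * h.
  move=> sh; split.
    apply: rP; first by rewrite /ball_/= sub0r normrN sh.
    by rewrite -normr_eq0 sh gt_eqF.
  rewrite -sh; apply: quot => //.
  have := dP (s *: delta_mx 0 i + p).
  by rewrite addrK enormZ edelta mulr1 sh dotZr dotC dot_delta; apply.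
have [] := step h (gtr0_norm h0).
have [] := step (- h); first by rewrite normrN gtr0_norm.
set X := _ *: _; set Y := _ *: _.
rewrite !ltr_distl => /andP[X1 X2] X3 /andP[Y1 Y2] Y3.
have : - e <= Y - q 0 i by rewrite -(ler_pM2l h0); lra.
have : X - q 0 i <= e by rewrite -(ler_pM2l h0); lra.
by rewrite ler_norml; lra.
Qed.

(** The subgradient inequality is tested in the direction q itself. *)
Lemma subgradient_bound f x q (L d : R) : 0 <= L -> 0 < d ->
  (forall y, enorm (y - x) < d -> f y - f x <= L * enorm (y - x)) ->
  frechet_subdiff f x q -> enorm q <= L.
Proof.
move=> L0 d0 fL /frechet_subdiffP fq.
have [->|q0] := eqVneq q 0; first by rewrite enorm0.
apply/ler_addgt0Pr => e e0; have [r r0 rP] := fq e e0.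
rewrite -enorm_gt0 in q0.
pose h := Num.min d r / 2 / enorm q.
have m0 : 0 < Num.min d r by rewrite lt_min d0.
have h0 : 0 < h by rewrite !divr_gt0.
have hm : h * enorm q < Num.min d r.
  by rewrite divfK ?gt_eqF// ltr_pdivrMr// ltr_pMr// ltr1n.
have hq : enorm (h *: q + x - x) = h * enorm q by rewrite addrK enormZ gtr0_norm.
move: hm; rewrite lt_min => /andP[hd hr].
have := fL (h *: q + x); have := rP (h *: q + x); rewrite hq => /(_ hr) + /(_ hd).
rewrite addrK dotZr -sqr_enorm => h1 h2.
have hq0 : 0 < h * enorm q by rewrite mulr_gt0.
rewrite -(ler_pM2l hq0); move: h1 h2; rewrite expr2; lra.
Qed.

(** On t -> f (x + t (y - x)) the midpoint inequality compares the values at t and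
    t / 2. Iterating it down to t = 2^-m, where the subgradient inequality is
    sharp to first order, the quadratic errors add up to a geometric series. *)
Lemma semiconvex_subgradient f x y q (r C : R) : 0 <= C ->
  (forall z h, (forall l : R, -1 <= l <= 1 -> cball 0 r (z + l *: h)) ->
     - (C * enorm h ^+ 2) <= f (z + h) + f (z - h) - 2 * f z) ->
  cball 0 r x -> cball 0 r y -> frechet_subdiff f x q ->
  dot q (y - x) - C * enorm (y - x) ^+ 2 <= f y - f x.
Proof.
move=> C0 fC rx ry /frechet_subdiffP fq; set u := y - x.
pose g t := f (x + t *: u) - f x - t * dot q u.
pose N := C * enorm u ^+ 2 / 4.
have N0 : 0 <= N by rewrite divr_ge0// mulr_ge0// sqr_ge0.
have seg (t : R) : 0 <= t <= 1 -> cball 0 r (x + t *: u).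
  move=> /andP[t0 t1]; rewrite /cball/= subr0.
  have -> : x + t *: u = (1 - t) *: x + t *: y.
    by rewrite /u scalerBr scalerBl scale1r addrCA addrA [RHS]addrC addrA.
  rewrite (le_trans (enormD _ _))// !enormZ !ger0_norm ?subr_ge0//.
  move: rx ry; rewrite /cball/= !subr0 => rx ry.
  have := ler_wpM2l t0 ry; have : (1 - t) * enorm x <= (1 - t) * r.
    by rewrite ler_wpM2l// subr_ge0.
  lra.
have halving (t : R) : 0 <= t <= 1 -> 2 * g (t / 2) - N * t ^+ 2 <= g t.
  move=> /andP[t0 t1]; have := fC (x + (t / 2) *: u) ((t / 2) *: u).
  rewrite addrK enormZ exprMn real_normK ?num_real//.
  have -> : x + t / 2 *: u + t / 2 *: u = x + t *: u.
    by rewrite -addrA -scalerDl -splitr.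
  move=> H.
  have {H} := H _; rewrite /g /N.
  have H l : -1 <= l <= 1 -> cball 0 r (x + (t / 2) *: u + l *: ((t / 2) *: u)).
    move=> /andP[l0 l1]; rewrite -addrA scalerA -scalerDl; apply: seg.
    have th : 0 <= t / 2 by rewrite divr_ge0.
    have lt2 : l * (t / 2) <= 1 * (t / 2) by rewrite ler_wpM2r.
    have lt1 : -1 * (t / 2) <= l * (t / 2) by rewrite ler_wpM2r.
    by apply/andP; split; lra.
  by move=> /(_ H); lra.
pose a m : R := 2^-1 ^+ m.
have a0 m : 0 < a m by rewrite exprn_gt0// invr_gt0.
have a1 m : a m <= 1 by rewrite exprn_ile1 ?invr_ge0// invf_le1// ler1n.
have aS m : a m.+1 = a m / 2 by rewrite /a exprSr.
have iter m : g (a m) - 2 * N * a m * (1 - a m) <= a m * g 1.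
  elim: m => [|m IH]; first by rewrite /a expr0 subrr !mulr0 subr0 mul1r.
  have := halving (a m); rewrite (ltW (a0 m)) a1 -aS => /(_ isT).
  rewrite aS; move: IH; set b := a m; set G := g (b / 2); rewrite expr2; lra.
suff : - (2 * N) <= g 1.
  have xu : x + u = y by rewrite /u addrC subrK.
  rewrite /g scale1r mul1r xu /N; have := mulr_ge0 C0 (sqr_ge0 (enorm u)); lra.
apply/ler_addgt0Pr => e e0.
have [u0|u0] := eqVneq u 0.
  rewrite /g /N u0 scaler0 addr0 subrr dot0r mulr0 subrr enorm0 expr0n/=.
  by rewrite mulr0 mul0r mulr0 oppr0 add0r ltW.
rewrite -enorm_gt0 in u0.
have [d d0 dP] := fq _ (divr_gt0 e0 u0).
have [m md] := half_pow_small (enorm u) d0.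
have := dP (x + a m *: u); rewrite addrC addKr enormZ gtr0_norm// dotZr.
rewrite mulrC md => /(_ isT); rewrite mulrA divfK ?gt_eqF//.
move=> gm; rewrite -(ler_pM2l (a0 m)); have := iter m; rewrite /g in gm *.
have : 0 <= N * a m ^+ 2 by rewrite mulr_ge0// sqr_ge0.
set G1 := f _ - f x - 1 * _ in gm *; set Gm := f _ - f x - a m * _ in gm *.
rewrite expr2; lra.
Qed.

End subgradients.

(** * The Hamiltonian and Lipschitz selections *)

Section hamiltonian.
Context {R : realType} {n : nat}.
Variable F : 'rV[R]_n -> set 'rV[R]_n.
Hypothesis hSH : SH F.
Implicit Types (x y p q v w : 'rV[R]_n) (r k : R).

Lemma SH_convex x v w (l : R) : F x v -> F x w -> 0 <= l <= 1 ->
  F x ((1 - l) *: v + l *: w).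
Proof.
move=> Fv Fw /andP[l0 l1]; have [_ cF _] : [/\ F x !=set0, convex_set (F x) & compact (F x)].
  by case: hSH => + _ _; apply.
have := cF w v (Itv01 l0 l1); rewrite !inE => /(_ Fw Fv).
by rewrite addrC.
Qed.

Lemma hamiltonian_attained x p :
  exists v, [/\ F x v, dot v p = hamiltonian F x p &
    forall w, F x w -> dot w p <= hamiltonian F x p].
Proof.
have [F0 _ cF] : [/\ F x !=set0, convex_set (F x) & compact (F x)].
  by case: hSH => + _ _; apply.
have [v /set_mem Fv vmax] := @EVT_max_rV _ _ (fun v => dot v p) _ F0 cF
  (continuous_subspaceT (@continuous_dot _ _ p)).
have vub w : F x w -> dot w p <= dot v p by move=> /mem_set; exact: vmax.
suff -> : hamiltonian F x p = dot v p by exists v.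
apply/eqP; rewrite eq_le; apply/andP; split.
  by apply: ge_sup => [|_ [w Fw <-]]; [exists (dot v p), v|exact: vub].
apply: ub_le_sup; last by exists v.
by exists (dot v p) => _ [w Fw <-]; exact: vub.
Qed.

Lemma hamiltonian_ub x p v : F x v -> dot v p <= hamiltonian F x p.
Proof. by have [_ [_ _]] := hamiltonian_attained x p; apply. Qed.

Lemma hamiltonian0 x : hamiltonian F x 0 = 0.
Proof. by have [v [_ <- _]] := hamiltonian_attained x 0; rewrite dot0r. Qed.

Lemma hamiltonianZ x p (l : R) : 0 <= l ->
  hamiltonian F x (l *: p) = l * hamiltonian F x p.
Proof.
move=> l0; have [v [Fv vE _]] := hamiltonian_attained x p.
have [w [Fw wE _]] := hamiltonian_attained x (l *: p).
apply/eqP; rewrite eq_le -{1}wE -vE dotZr ler_wpM2l ?vE ?hamiltonian_ub//=.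
by rewrite -vE -dotZr hamiltonian_ub.
Qed.

(** The Hamiltonian is a supremum of linear functions of the costate, and v gives
    one that touches it at p. *)
Lemma maximizer_subgradient x p v : F x v -> dot v p = hamiltonian F x p ->
  frechet_subdiff (hamiltonian F x) p v.
Proof.
move=> Fv vE; apply/frechet_subdiffP => e e0; exists 1 => // q _.
apply: (@le_trans _ _ 0); first by rewrite oppr_le0 mulr_ge0 ?enorm_ge0// ltW.
by rewrite dotBr vE; have := hamiltonian_ub q Fv; lra.
Qed.

Hypothesis hH : HH F.

Lemma hamiltonian_differentiable x p : p != 0 ->
  differentiable (hamiltonian F x) p.
Proof.
move=> p0; have r0 : 0 < enorm x + 1 by rewrite ltr_wpDl ?enorm_ge0.
have [_ [+ _]] := hH r0; apply=> //.
by rewrite /cball/= subr0 lerDl.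
Qed.

Notation G x p := (gradient (hamiltonian F x) p).

Lemma maximizer_gradient x p v : p != 0 -> F x v ->
  dot v p = hamiltonian F x p -> v = G x p.
Proof.
move=> p0 Fv vE; apply: subgradient_derivable; first exact: maximizer_subgradient.
exact: hamiltonian_differentiable.
Qed.

Lemma gradientP x p : p != 0 -> F x (G x p) /\ dot (G x p) p = hamiltonian F x p.
Proof.
move=> p0; have [v [Fv vE _]] := hamiltonian_attained x p.
by rewrite -(maximizer_gradient p0 Fv vE).
Qed.

Lemma gradient_subgradient x p v : p != 0 ->
  frechet_subdiff (hamiltonian F x) p v -> v = G x p.
Proof.
by move=> p0 /subgradient_derivable; apply; exact: hamiltonian_differentiable.
Qed.

Definition gradient_lip r k := forall p, p != 0 ->
    forall x z, cball 0 r x -> cball 0 r z ->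
      enorm (G x p - G z p) <= k * enorm (x - z).

(** The value at x is the pairing of p with the gradient at x, and the gradient at
    z is an admissible velocity at z, close to the former. *)
Lemma hamiltonian_lip r k x z p : gradient_lip r k -> cball 0 r x ->
  cball 0 r z ->
  hamiltonian F x p - hamiltonian F z p <= k * enorm p * enorm (x - z).
Proof.
move=> Glip rx rz; have [->|p0] := eqVneq p 0.
  by rewrite !hamiltonian0 subrr enorm0 mulr0 mul0r.
have [_ <-] := gradientP x p0; have [Fz _] := gradientP z p0.
apply: (@le_trans _ _ (dot (G x p - G z p) p)).
  by rewrite dotBl lerD2l lerN2 hamiltonian_ub.
rewrite (le_trans (dot_le _ _))// mulrAC ler_wpM2r ?enorm_ge0//.
exact: Glip.
Qed.

(** The maximizer of dot v p over F x is unique, so by compactness the velocities at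
    distance at least e from it leave a gap below the Hamiltonian; a small
    change of p cannot close the gap. *)
Lemma gradient_continuous x p (e : R) : p != 0 -> 0 < e ->
  exists2 d : R, 0 < d & forall q, q != 0 -> enorm (q - p) < d ->
    enorm (G x q - G x p) < e.
Proof.
move=> p0 e0; have [_ _ [gam gam0 gamP]] := hSH.
set M := gam * (1 + enorm x); have FM v : F x v -> enorm v <= M by exact: gamP.
have [Fp pE] := gradientP x p0.
have M0 : 0 <= M := le_trans (enorm_ge0 _) (FM _ Fp).
pose K := F x `&` [set v | e <= enorm (v - G x p)].
have [K0|/set0P K0] := eqVneq K set0.
  exists 1 => // q q0 _; rewrite ltNge; apply/negP => qe.
  have [Fq _] := gradientP x q0.
  have : K (G x q) by split.
  by rewrite K0.
have cK : compact K.
  have [F0 _ cF] : [/\ F x !=set0, convex_set (F x) & compact (F x)].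
    by case: hSH => + _ _; apply.
  apply: (subclosed_compact _ cF); last by move=> v [].
  apply: closedI; first by apply: compact_closed => //; exact: norm_hausdorff.
  apply: (@preimage_closed _ _ (fun v : 'rV[R]_n => enorm (v - G x p)) [set t : R | e <= t]).
    by move=> v _; exact: continuous_enormB.
  exact: closed_ge.
have [v /set_mem[Fv ve] vmax] := @EVT_max_rV _ _ (fun v => dot v p) _ K0 cK
  (continuous_subspaceT (@continuous_dot _ _ p)).
set gap := hamiltonian F x p - dot v p.
have gap0 : 0 < gap.
  rewrite subr_gt0 lt_neqAle hamiltonian_ub// andbT; apply/eqP => vE.
  by move: ve; rewrite /= -(maximizer_gradient p0 Fv vE) subrr enorm0 leNgt e0.
have M21 : 0 < 2 * M + 1 by rewrite ltr_wpDl// mulr_ge0.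
exists (gap / (2 * M + 1)) => [|q q0]; first by rewrite divr_gt0.
rewrite ltr_pdivlMr// => qp; rewrite ltNge; apply/negP => qe.
have [Fq qE] := gradientP x q0.
have := vmax (G x q); rewrite inE => /(_ (conj Fq qe)).
have h1 : dot (G x q) p = hamiltonian F x q - dot (G x q) (q - p).
  by rewrite dotBr qE; ring.
have h2 := hamiltonian_ub q Fp.
have h3 : dot (G x p) q = hamiltonian F x p + dot (G x p) (q - p).
  by rewrite dotBr pE; ring.
have h4 : dot (G x q) (q - p) <= M * enorm (q - p).
  by rewrite (le_trans (dot_le _ _))// ler_wpM2r ?enorm_ge0// FM.
have h5 : - (M * enorm (q - p)) <= dot (G x p) (q - p).
  by rewrite (le_trans _ (dot_ge _ _))// lerN2 ler_wpM2r ?enorm_ge0// FM.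
by have := enorm_ge0 (q - p); rewrite /gap in qp gap0; lra.
Qed.

(** Semiconvexity is assumed for unit costates; positive homogeneity in p extends
    its consequence to all of them. *)
Lemma hamiltonian_semiconvex r : 0 < r -> exists2 c : R, 0 <= c &
  forall x y p q, cball 0 r x -> cball 0 r y ->
    frechet_subdiff (fun z => hamiltonian F z p) x q -> p != 0 ->
    dot q (y - x) - c * enorm p * enorm (y - x) ^+ 2
      <= hamiltonian F y p - hamiltonian F x p.
Proof.
move=> r0; have [[c c0 cP] _] := hH r0; exists c => // x y p q rx ry Hq p0.
have P0 : 0 < enorm p by rewrite enorm_gt0.
apply: (@semiconvex_subgradient _ _ (fun z => hamiltonian F z p) x y q r) => //.
  by rewrite mulr_ge0 ?enorm_ge0.
move=> z h zh; pose u := (enorm p)^-1 *: p.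
have u1 : enorm u = 1 by rewrite enormZ gtr0_norm ?invr_gt0// mulVf// gt_eqF.
have pE z' : hamiltonian F z' p = enorm p * hamiltonian F z' u.
  by rewrite -hamiltonianZ ?enorm_ge0// scalerA divff ?gt_eqF// scale1r.
have [_ /(_ z h zh)] := cP u u1.
by rewrite !pE -(ler_pM2l P0); lra.
Qed.

(** Fields that steer trajectories inside a ball. Unlike the gradient fields of fixed
    costates they form a convex set, as separation requires. *)
Definition lip_selection r k (f : 'rV[R]_n -> 'rV[R]_n) :=
  (forall y, cball 0 r y -> F y (f y)) /\
  forall y z, cball 0 r y -> cball 0 r z -> enorm (f y - f z) <= k * enorm (y - z).

Lemma lip_selection_gradient r k p : gradient_lip r k -> p != 0 ->
  lip_selection r k (fun y => G y p).
Proof.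
move=> Glip p0; split=> [y _|]; first by have [] := gradientP y p0.
exact: Glip.
Qed.

Lemma lip_selection_convex r k f g (l : R) : lip_selection r k f ->
  lip_selection r k g -> 0 <= l <= 1 ->
  lip_selection r k (fun y => (1 - l) *: f y + l *: g y).
Proof.
move=> [Ff fL] [Fg gL] l01; split=> [y ry|y z ry rz].
  by apply: SH_convex => //; [exact: Ff|exact: Fg].
rewrite opprD addrACA -!scalerBr (le_trans (enormD _ _))// !enormZ.
case/andP: l01 => l0 l1; rewrite !ger0_norm ?subr_ge0//.
have := ler_wpM2l l0 (gL y z ry rz).
have : (1 - l) * enorm (f y - f z) <= (1 - l) * (k * enorm (y - z)).
  by rewrite ler_wpM2l ?subr_ge0// fL.
lra.
Qed.

(** Separation by the Frank-Wolfe argument: if every selection stayed at distance at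
    least eps + eta from w at x, then moving a nearly closest one towards the
    gradient field of the costate p = w - f x, which maximizes the pairing with p,
    would bring it below the infimum of the distances. *)
Lemma lip_selection_approx r k x w (eps eta : R) p0 : gradient_lip r k ->
  p0 != 0 -> cball 0 r x -> 0 <= eps -> 0 < eta ->
  (forall p, dot w p <= hamiltonian F x p + eps * enorm p) ->
  exists2 f, lip_selection r k f & enorm (f x - w) < eps + eta.
Proof.
move=> Glip p00 rx eps0 eta0 wH; apply: contrapT => H.
set rho := eps + eta; have rho0 : 0 < rho by rewrite ltr_wpDl.
have far f : lip_selection r k f -> rho <= enorm (w - f x).
  move=> sf; rewrite leNgt; apply/negP => fw; apply: H.
  by exists f => //; rewrite enorm_sym.
pose S := [set enorm (w - f x) ^+ 2 | f in lip_selection r k].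
have S0 : S !=set0.
  by eexists; eexists; first exact: (lip_selection_gradient Glip p00).
have infS : has_inf S by split=> //; exists 0 => _ [f _ <-]; rewrite sqr_ge0.
have [_ _ [gam gam0 gamP]] := hSH.
set M := gam * (1 + enorm x); have FM v : F x v -> enorm v <= M by exact: gamP.
have M0 : 0 <= M.
  by have [v [Fv _ _]] := hamiltonian_attained x 0; exact: le_trans (enorm_ge0 _) (FM _ Fv).
pose N := 1 + (2 * M) ^+ 2; have N0 : 0 < N by rewrite ltr_pwDl// sqr_ge0.
pose l := Num.min 1 (rho * eta / N).
have re0 : 0 < rho * eta by rewrite mulr_gt0.
have l0 : 0 < l by rewrite lt_min ltr01 divr_gt0.
have l1 : l <= 1 by rewrite ge_min lexx.
have lN : l * N <= rho * eta by rewrite -ler_pdivlMr// ge_min lexx orbT.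
have l2 : 0 < l ^+ 2 by rewrite exprn_gt0.
have [_ [f sf <-] fS] := inf_adherent l2 infS.
set p := w - f x in fS.
have p0' : rho <= enorm p by exact: far.
have pn0 : p != 0 by rewrite -enorm_gt0 (lt_le_trans rho0).
have sg := lip_selection_gradient Glip pn0.
have l01 : 0 <= l <= 1 by rewrite l1 ltW.
have : inf S <= enorm (w - ((1 - l) *: f x + l *: G x p)) ^+ 2.
  apply: ge_inf; first by case: infS.
  exists (fun y => (1 - l) *: f y + l *: G y p) => //.
  exact: lip_selection_convex.
have -> : w - ((1 - l) *: f x + l *: G x p) = p - l *: (G x p - f x).
  by apply/rowP => i; rewrite /p !mxE; ring.
have [FG GE] := gradientP x pn0.
have h1 : enorm p * eta <= dot p (G x p - f x).
  rewrite dotBr (dotC p) GE.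
  have := wH p; have : dot w p = enorm p ^+ 2 + dot p (f x).
    by rewrite sqr_enorm {2}/p dotBl (dotC (f x)) (dotC w); ring.
  move=> ->; have : rho * enorm p <= enorm p * enorm p by rewrite ler_wpM2r ?enorm_ge0.
  rewrite /rho expr2; lra.
have h2 : enorm (G x p - f x) ^+ 2 <= (2 * M) ^+ 2.
  rewrite ler_pXn2r// ?nnegrE ?enorm_ge0//; last by move: M0; lra.
  rewrite (le_trans (enormD _ _))// enormN.
  have := FM _ FG; have [Ff _] := sf; have := FM _ (Ff x rx); lra.
have h3 : rho * eta <= enorm p * eta by rewrite ler_wpM2r// ltW.
rewrite sqr_enormB dotZr enormZ exprMn (gtr0_norm l0).
have h4 : l * (rho * eta) <= l * dot p (G x p - f x).
  by rewrite ler_wpM2l ?(ltW l0)// (le_trans h3).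
have h5 : l ^+ 2 * enorm (G x p - f x) ^+ 2 <= l ^+ 2 * (2 * M) ^+ 2.
  by rewrite ler_wpM2l// ltW.
have h6 : l * (l * N) <= l * (rho * eta) by rewrite ler_wpM2l// ltW.
have h7 : 0 < l * (rho * eta) by rewrite mulr_gt0.
move: fS h5 h6; rewrite /N !expr2; lra.
Qed.

End hamiltonian.

(** * Clamping vectors to a box *)

Section vclamp.
Context {R : realType} {n : nat}.
Implicit Types (x y z : 'rV[R]_n) (rho : R).

Lemma enorm_le_coord x y : (forall i, `|x 0 i| <= `|y 0 i|) -> enorm x <= enorm y.
Proof.
move=> xy; rewrite -ler_sqr ?nnegrE ?enorm_ge0// !sqr_enorm.
apply: ler_sum => i _; rewrite -!expr2 -(real_normK (num_real (x 0 i))).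
by rewrite -(real_normK (num_real (y 0 i))) ler_sqr ?nnegrE.
Qed.

(** Clamping coordinates is a retraction onto a box that does not increase Euclidean
    distances; balls are reached only
    through the comparison of the two norms. *)
Definition vclamp rho y : 'rV[R]_n := \row_i clamp (- rho) rho (y 0 i).

Lemma vclamp_cball rho y : 0 <= rho -> cball 0 (n%:R * rho) (vclamp rho y).
Proof.
move=> rho0; rewrite /cball/= subr0 (le_trans (enorm_le_norm _))// ler_wpM2l//.
apply: norm_le_coord => // i; rewrite mxE ler_norml; apply: clamp_itv; lra.
Qed.

Lemma vclamp_lip rho y z : enorm (vclamp rho y - vclamp rho z) <= enorm (y - z).
Proof. by apply: enorm_le_coord => i; rewrite !mxE clamp_lip. Qed.

Lemma vclamp_enorm rho y : 0 <= rho -> enorm (vclamp rho y) <= enorm y.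
Proof. by move=> rho0; apply: enorm_le_coord => i; rewrite mxE clamp_norm. Qed.

Lemma vclamp_id rho y : enorm y <= rho -> vclamp rho y = y.
Proof.
move=> yrho; apply/rowP => i; rewrite mxE clamp_id// -ler_norml.
exact: le_trans (coord_le_enorm _ _) yrho.
Qed.

End vclamp.

(** * Gronwall estimates for arcs *)

Section arc_estimates.
Context {R : realType} {n : nat}.
Implicit Types (a b s t k : R) (y : R -> 'rV[R]_n).

Lemma is_arc_clamp_continuous a b y : a <= b -> is_arc a b y ->
  forall s e, 0 < e -> exists2 d : R, 0 < d & forall t, `|t - s| < d ->
    enorm (y (clamp a b t) - y (clamp a b s)) < e.
Proof.
move=> ab ay s e e0; have [d d0 dP] := ay e e0.
exists d => // t ts.
have H u v : a <= u -> u <= v -> v <= b -> v - u < d -> enorm (y v - y u) < e.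
  move=> au uv vb vud; have := dP 1 (fun=> u) (fun=> v).
  rewrite !big_ord1; apply=> //.
  by move=> i j _ _ _; rewrite !ord1.
have /andP[as_ sb] := clamp_itv s ab; have /andP[at_ tb] := clamp_itv t ab.
have := le_lt_trans (clamp_lip a b s t) ts.
have [st|ts'] := leP (clamp a b s) (clamp a b t).
  by rewrite ger0_norm ?subr_ge0// => /(H _ _ as_ st tb).
by rewrite ltr0_norm ?subr_lt0// opprB enorm_sym => /(H _ _ at_ (ltW ts') sb).
Qed.

Lemma arc_bounded a b y : a <= b -> is_arc a b y ->
  exists2 B : R, 0 <= B & forall s, a <= s <= b -> enorm (y s) <= B.
Proof.
move=> ab ay; have [B B0 BP] := abs_cont_bounded ab (abs_cont_dot ab ay ay).
exists (1 + B) => [|s sab]; first by rewrite addr_ge0.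
have := BP s sab; rewrite -sqr_enorm ger0_norm ?sqr_ge0// => sB.
by have := sqr_ge0 (enorm (y s) - 1); rewrite sqrrB; lra.
Qed.

Lemma is_derive_sqr_enorm y s (v : 'rV[R]_n) : is_derive s (1 : R) y v ->
  is_derive s (1 : R) (fun t => enorm (y t) ^+ 2) (2 * dot (y s) v).
Proof.
move=> yv; rewrite (_ : (fun t => _) = fun t => dot (y t) (y t)).
  apply: (is_derive_subst (is_derive_dot yv yv)).
  by rewrite (dotC v); ring.
by apply/funext => t; rewrite sqr_enorm.
Qed.

Lemma abs_cont_sqr_enorm a b y : a <= b -> is_arc a b y ->
  abs_cont a b (fun t => enorm (y t) ^+ 2).
Proof.
move=> ab ay; rewrite (_ : (fun t => _) = fun t => dot (y t) (y t)).
  exact: abs_cont_dot.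
by apply/funext => t; rewrite sqr_enorm.
Qed.

Lemma enorm_le_exp (u w : R) (k d : R) : 0 <= u -> 0 <= w ->
  expR (- (2 * k) * d) * u ^+ 2 <= w ^+ 2 -> u <= expR (k * d) * w.
Proof.
move=> u0 w0 H.
rewrite -ler_sqr ?nnegrE// ?mulr_ge0 ?expR_ge0// exprMn.
have -> : expR (k * d) ^+ 2 = expR (k * d + k * d) by rewrite expRD.
rewrite -(ler_pM2l (expR_gt0 (- (2 * k) * d))) [leRHS]mulrA -expRD.
by rewrite (_ : - (2 * k) * d + (k * d + k * d) = 0) ?expR0 ?mul1r//; ring.
Qed.

(** Gronwall's inequality for the squared norm, in both directions of time. *)
Lemma arc_gronwall a b k y : 0 <= k -> is_arc a b y ->
  {ae (@lebesgue_measure R), forall s, s \in `[a, b] ->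
     exists2 v, is_derive s (1 : R) y v & enorm v <= k * enorm (y s)} ->
  forall s t, a <= s -> s <= t -> t <= b ->
    enorm (y s) <= expR (k * (t - s)) * enorm (y t) /\
    enorm (y t) <= expR (k * (t - s)) * enorm (y s).
Proof.
move=> k0 ay aey s t as_ st tb.
have ay' : is_arc s t y by exact: is_arc_sub ay.
have ac := abs_cont_sqr_enorm st ay'.
have dotb v x : enorm v <= k * enorm x -> `|dot x v| <= k * enorm x ^+ 2.
  move=> vk; rewrite (le_trans (dot_le_enorm _ _))// expr2 mulrCA.
  by rewrite ler_wpM2l ?enorm_ge0.
have sub r : r \in `[s, t] -> r \in `[a, b].
  rewrite !in_itv/= => /andP[sr rt].
  by rewrite (le_trans as_ sr) (le_trans rt tb).
split; apply: enorm_le_exp; rewrite ?enorm_ge0//.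
- apply: (@gronwall _ s t (- (2 * k)) (fun r => enorm (y r) ^+ 2)) => //.
  apply: ae_imp aey => r H /sub /H[v yv /dotb].
  rewrite ler_norml => /andP[vk _].
  by exists (2 * dot (y r) v); [exact: is_derive_sqr_enorm|lra].
- have := @gronwall _ s t (2 * k) (fun r => - enorm (y r) ^+ 2) st.
  move=> /(_ (abs_contN st ac)) H.
  have {H} : expR (2 * k * (t - s)) * - enorm (y s) ^+ 2 <= - enorm (y t) ^+ 2.
    apply: H; apply: ae_imp aey => r H /sub /H[v yv /dotb].
    rewrite ler_norml => /andP[_ vk].
    by exists (- (2 * dot (y r) v)); [exact: is_deriveN (is_derive_sqr_enorm yv)|lra].
  rewrite mulrN lerN2 -(ler_pM2l (expR_gt0 (- (2 * k) * (t - s)))) [leRHS]mulrA -expRD.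
  by rewrite (_ : - (2 * k) * (t - s) + 2 * k * (t - s) = 0) ?expR0 ?mul1r//; ring.
Qed.

(** Gronwall's inequality for 1 + |y|^2, whose derivative is at most 4 gam times
    itself. *)
Lemma linear_growth a b (gam : R) y : 0 <= gam -> is_arc a b y ->
  {ae (@lebesgue_measure R), forall s, s \in `[a, b] ->
     exists2 v, is_derive s (1 : R) y v & enorm v <= gam * (1 + enorm (y s))} ->
  forall s, a <= s <= b ->
    enorm (y s) <= expR (4 * gam * (b - a)) * (1 + enorm (y a) ^+ 2).
Proof.
move=> gam0 ay aey s /andP[as_ sb].
have ay' : is_arc a s y by exact: is_arc_sub ay.
have ac : abs_cont a s (fun r => - (1 + enorm (y r) ^+ 2)).
  by apply: abs_contN => //; apply: abs_contD; [exact: abs_cont_cst|exact: abs_cont_sqr_enorm].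
have := @gronwall _ a s (4 * gam) _ as_ ac => H.
have {H} : expR (4 * gam * (s - a)) * - (1 + enorm (y a) ^+ 2) <= - (1 + enorm (y s) ^+ 2).
  apply: H; apply: ae_imp aey => r H; rewrite in_itv/= => /andP[ar rs].
  have [|v yv vg] := H; first by rewrite in_itv/= ar (le_trans rs).
  exists (- (0 + 2 * dot (y r) v)).
    exact: is_deriveN (is_deriveD (is_derive_cst _ _ _) (is_derive_sqr_enorm yv)).
  have h1 : dot (y r) v <= enorm (y r) * (gam * (1 + enorm (y r))).
    by rewrite (le_trans (dot_le _ _))// ler_wpM2l ?enorm_ge0.
  have h2 : 0 <= gam * (enorm (y r) - 1) ^+ 2 by rewrite mulr_ge0// sqr_ge0.
  have h3 : 0 <= gam * enorm (y r) ^+ 2 by rewrite mulr_ge0// sqr_ge0.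
  by rewrite sqrrB1 in h2; rewrite !expr2 in h2 h3 *; lra.
rewrite mulrN lerN2 => H.
apply: (@le_trans _ _ (1 + enorm (y s) ^+ 2)).
  by have := sqr_ge0 (enorm (y s) - 1); rewrite sqrrB1 mulr2n; have := sqr_ge0 (enorm (y s)); lra.
apply: le_trans H _; rewrite ler_wpM2r ?addr_ge0 ?sqr_ge0// ler_expR.
by rewrite ler_wpM2l ?mulr_ge0// lerD2r.
Qed.

End arc_estimates.

(** * Trajectories and the value function *)

Section trajectories.
Context {R : realType} {n : nat}.
Variable F : 'rV[R]_n -> set 'rV[R]_n.
Hypotheses (hSH : SH F) (hH : HH F).
Implicit Types (a b c s t T k rho : R) (x : 'rV[R]_n) (y z : R -> 'rV[R]_n).

Lemma is_derive_derive1 y s : derivable y s 1 -> is_derive s (1 : R) y (derive1 y s).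
Proof. by move=> dy; rewrite derive1E; exact: derivableP. Qed.

Lemma trajectory_derive T t x y : trajectory F T t x y ->
  {ae (@lebesgue_measure R), forall s, s \in `[t, T] ->
     exists2 v, is_derive s (1 : R) y v & F (y s) v}.
Proof.
move=> [_ + _]; apply: ae_imp => s H /H[dy Fy].
by exists (derive1 y s) => //; exact: is_derive_derive1.
Qed.

Lemma trajectory_sub T t x y a b : trajectory F T t x y -> t <= a -> b <= T ->
  trajectory F b a (y a) y.
Proof.
move=> [ay aey _] ta bT; split=> //; first exact: is_arc_sub ay.
apply: ae_imp aey => s H; rewrite in_itv/= => /andP[as_ sb]; apply: H.
by rewrite in_itv/= (le_trans ta as_) (le_trans sb bT).
Qed.

(** The two pieces agree at c, and c is one point, hence negligible for the
    differential inclusion. *)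
Lemma trajectory_cat a c b x y z : a <= c -> c <= b ->
  trajectory F c a x y -> trajectory F b c (y c) z ->
  trajectory F b a x (fun s => if s <= c then y s else z s).
Proof.
move=> ac cb [ay aey yx] [az aez zy]; split; last by rewrite ac.
  exact: is_arc_cat.
have := ae_imp2 (fun s P Q => conj P Q) aey aez.
apply: ae_imp2 (ae_neq c) => s sc [ys zs]; rewrite in_itv/= => /andP[as_ sb].
pose yz (r : R) := if r <= c then y r else z r.
have sd (w : R -> 'rV[R]_n) : nbhs s (fun r : R => w r = yz r) ->
    derivable w s 1 /\ F (w s) (derive1 w s) ->
    derivable yz s 1 /\ F (yz s) (derive1 yz s).
  move=> near_w [dw Fw]; split; first exact: near_eq_derivable near_w dw.
  rewrite derive1E -(near_eq_derive _ near_w) -derive1E.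
  by have := nbhs_singleton near_w => <-.
change (derivable yz s 1 /\ F (yz s) (derive1 yz s)).
have [slc|cls] := leP s c.
- apply: (sd y); last by apply: ys; rewrite in_itv/= as_.
  have {}slc : s < c by rewrite lt_neqAle sc.
  by apply: filterS (lt_nbhsl slc) => r /ltW rc; rewrite /yz rc.
- apply: (sd z); last by apply: zs; rewrite in_itv/= sb ltW.
  by apply: filterS (lt_nbhsr cls) => r cr; rewrite /yz leNgt cr.
Qed.

(** Clamping the state makes the field globally Lipschitz and bounded; solutions
    that stay in the box follow the original field. *)
Lemma selection_flow rho k (f : R -> 'rV[R]_n -> 'rV[R]_n) c x :
  0 <= rho -> 0 <= k ->
  (forall s, lip_selection F (n%:R * rho) k (f s)) ->
  (forall v : 'rV[R]_n, cball 0 (n%:R * rho) v -> continuous (f^~ v)) ->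
  exists2 y, y c = x & forall s, is_derive s (1 : R) y (f s (vclamp rho (y s))).
Proof.
move=> rho0 k0 fsel fcont; have [_ _ [gam gam0 gamP]] := hSH.
have L0 : 0 < k * n%:R + 1 by rewrite ltr_wpDl// mulr_ge0.
apply: (@picard _ _ (fun s (v : 'rV[R]_n) => f s (vclamp rho v)) c (k * n%:R + 1)
    (gam * (1 + n%:R * rho)) x L0) => [v|s v w|s v].
- by apply: fcont; exact: vclamp_cball.
- have [_ /(_ _ _ (vclamp_cball v rho0) (vclamp_cball w rho0))] := fsel s.
  move=> H; rewrite (le_trans (norm_le_enorm _))// (le_trans H)//.
  apply: (@le_trans _ _ (k * (n%:R * `|v - w|))).
    by rewrite ler_wpM2l// (le_trans (vclamp_lip _ _ _))// enorm_le_norm.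
  by rewrite mulrA ler_wpM2r// lerDl.
- have [/(_ _ (vclamp_cball v rho0)) Ff _] := fsel s.
  rewrite (le_trans (norm_le_enorm _))// (le_trans (gamP _ _ Ff))//.
  rewrite ler_wpM2l ?(ltW gam0)// lerD2l.
  by have := vclamp_cball v rho0; rewrite /cball/= subr0.
Qed.

Lemma flow_trajectory rho k (f : R -> 'rV[R]_n -> 'rV[R]_n) y a b :
  (forall s, lip_selection F (n%:R * rho) k (f s)) -> 0 <= rho ->
  (forall s, is_derive s (1 : R) y (f s (vclamp rho (y s)))) ->
  (forall s, a <= s <= b -> enorm (y s) <= rho) ->
  trajectory F b a (y a) y.
Proof.
move=> fsel rho0 dy yrho; have [_ _ [gam gam0 gamP]] := hSH.
have Ff s : F (vclamp rho (y s)) (f s (vclamp rho (y s))).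
  by have [+ _] := fsel s; apply; exact: vclamp_cball.
split=> //.
  apply: (@is_arc_lip _ _ _ _ _ (gam * (1 + rho))).
  apply: (@derive_lip _ _ a b y (fun s => f s (vclamp rho (y s)))) => // s sab.
  rewrite (le_trans (gamP _ _ (Ff s)))// ler_wpM2l ?(ltW gam0)// lerD2l.
  by rewrite (le_trans (vclamp_enorm _ _))// yrho.
apply: aeW => s; rewrite in_itv/= => sab; have ds := dy s; split; first by have := ds.
rewrite derive1E (@derive_val _ _ _ _ _ _ _ ds).
by have := Ff s; rewrite {1}vclamp_id// yrho.
Qed.

Lemma trajectory_bounded x t T : exists2 B : R, 0 <= B & forall y,
  trajectory F T t x y -> forall s, t <= s <= T -> enorm (y s) <= B.
Proof.
have [_ _ [gam gam0 gamP]] := hSH.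
exists (expR (4 * gam * (T - t)) * (1 + enorm x ^+ 2)).
  by rewrite mulr_ge0 ?expR_ge0// addr_ge0// sqr_ge0.
move=> y ty s sT; have [ay _ yx] := ty; rewrite -yx.
apply: (linear_growth (ltW gam0) ay) sT.
apply: ae_imp (trajectory_derive ty) => r H /H[v yv Fv].
by exists v => //; exact: gamP.
Qed.

Lemma gradient_lipP (r : R) : 0 < r -> exists2 k : R, 0 <= k & gradient_lip F r k.
Proof. by move=> r0; have [_ [_ [k k0 kP]]] := hH r0; exists k. Qed.

(** Clamp to a box that contains every state allowed by the linear growth of F: the
    clamped field has the same growth, so its solution never reaches the
    boundary. *)
Lemma trajectory_exists (p0 : 'rV[R]_n) t T x : p0 != 0 -> t <= T ->
  exists y, trajectory F T t x y.
Proof.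
move=> p00 tT; have [_ _ [gam gam0 gamP]] := hSH.
pose rho := expR (4 * gam * (T - t)) * (1 + enorm x ^+ 2).
have rho0 : 0 < rho by rewrite mulr_gt0 ?expR_gt0// ltr_pwDl// sqr_ge0.
have n0 : (0 < n)%N by case: (n) p0 p00 => // p0; rewrite [p0]thinmx0 eqxx.
have r0 : 0 < n%:R * rho by rewrite mulr_gt0// ltr0n.
have [k k0 kP] := gradient_lipP r0.
pose f (s : R) (v : 'rV[R]_n) := gradient (hamiltonian F v) p0.
have fsel s : lip_selection F (n%:R * rho) k (f s).
  exact: lip_selection_gradient.
have [|y yt dy] := @selection_flow rho k f t x (ltW rho0) k0 fsel.
  by move=> y _ s; exact: cvg_cst.
have Ff s : F (vclamp rho (y s)) (f s (vclamp rho (y s))).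
  by have [+ _] := fsel s; apply; apply: vclamp_cball; exact: ltW.
exists y; rewrite -{1}yt; apply: (flow_trajectory fsel (ltW rho0) dy).
rewrite /rho -yt; apply: (linear_growth (ltW gam0)).
  apply: (@is_arc_lip _ _ _ _ _ (gam * (1 + n%:R * rho))).
  apply: (@derive_lip _ _ t T y (fun s => f s (vclamp rho (y s)))) => // s sab.
  rewrite (le_trans (gamP _ _ (Ff s)))// ler_wpM2l ?(ltW gam0)// lerD2l.
  by have := vclamp_cball (y s) (ltW rho0); rewrite /cball/= subr0.
apply: aeW => s _; exists (f s (vclamp rho (y s))); first exact: dy.
rewrite (le_trans (gamP _ _ (Ff s)))// ler_wpM2l ?(ltW gam0)// lerD2l.
by rewrite vclamp_enorm// ltW.
Qed.

Variable phi : 'rV[R]_n -> R.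
Hypothesis hphi : locally_lipschitz phi.

Lemma locally_lipschitz_continuous : continuous phi.
Proof.
apply: enorm_continuous => x e e0; have [K xK [c c0 cP]] := hphi x.
have /near_enormP[d d0 dK] := xK.
exists (Num.min d (e / c)); first by rewrite lt_min d0 divr_gt0.
move=> y; rewrite lt_min ltr_pdivlMr// => /andP[yd yc].
rewrite distrC (le_lt_trans (cP x y (nbhs_singleton xK) (dK _ yd)))//.
by rewrite mulrC.
Qed.

(** All states reachable at time T lie in a compact ball, on which phi has a
    minimum. *)
Lemma payoff_lbounded t T x : t <= T ->
  has_lbound [set phi (y T) | y in trajectory F T t x].
Proof.
move=> tT; have [B B0 BP] := trajectory_bounded x t T.
pose K := [set v : 'rV[R]_n | enorm (v - 0) <= B].
have K0 : K !=set0 by exists 0; rewrite /K/= subrr enorm0.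
have cK : compact K.
  apply: bounded_closed_compact.
    exists B; split; first exact: num_real.
    move=> M BM v; rewrite /K/= subr0 => vB.
    by rewrite (le_trans (norm_le_enorm _))// (le_trans vB)// ltW.
  apply: (@preimage_closed _ _ (fun v : 'rV[R]_n => enorm (v - 0)) [set t : R | t <= B]).
    by move=> v _; exact: continuous_enormB.
  exact: closed_le.
have [v _ vmin] := EVT_min_rV K0 cK (continuous_subspaceT locally_lipschitz_continuous).
exists (phi v) => _ [y ty <-]; apply: vmin; rewrite inE /K/= subr0.
by apply: (BP _ ty); rewrite lexx tT.
Qed.

Lemma value_le_payoff t T x y : t <= T -> trajectory F T t x y ->
  value F phi T t x <= phi (y T).
Proof. by move=> tT ty; apply: ge_inf; [exact: payoff_lbounded|exists y]. Qed.

(** Dynamic programming: any continuation of y after b competes in the problem that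
    starts at a. *)
Lemma value_le_trajectory (p0 : 'rV[R]_n) T a b x y : p0 != 0 -> a <= b -> b <= T ->
  trajectory F b a x y -> value F phi T a x <= value F phi T b (y b).
Proof.
move=> p00 ab bT ty; apply: lb_le_inf.
  by have [z tz] := trajectory_exists (y b) p00 bT; exists (phi (z T)), z.
move=> _ [z tz <-].
have := value_le_payoff (le_trans ab bT) (trajectory_cat ab bT ty tz).
rewrite -/(value F phi T a x) => /le_trans; apply.
case: (leP T b) => // Tb; have -> : T = b by apply/eqP; rewrite eq_le Tb bT.
by have [_ _ ->] := tz.
Qed.

End trajectories.

(** * Pulling perturbations back along the optimal trajectory *)

Section transport.
Context {R : realType} {n : nat}.
Variables (F : 'rV[R]_n -> set 'rV[R]_n) (phi : 'rV[R]_n -> R).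
Hypotheses (hSH : SH F) (hH : HH F) (hphi : locally_lipschitz phi).
(* Any nonzero costate e0 has a gradient field, hence a Lipschitz selection of F. *)
Variable e0 : 'rV[R]_n.
Hypothesis e00 : e0 != 0.
Variables (t0 T : R) (x0 : 'rV[R]_n) (xbar pbar : R -> 'rV[R]_n).
Hypotheses (txbar : trajectory F T t0 x0 xbar) (apbar : is_arc t0 T pbar).
Hypothesis hsys : {ae (@lebesgue_measure R), forall s : R, s \in `[t0, T] ->
       [/\ derivable xbar s 1, derivable pbar s 1,
           frechet_subdiff (fun p => hamiltonian F (xbar s) p) (pbar s)
             (derive1 xbar s)
         & frechet_subdiff (fun x => hamiltonian F x (pbar s)) (xbar s)
             (- derive1 pbar s)]}.
Implicit Types (a b s t : R) (x z : 'rV[R]_n).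

Notation V t x := (value F phi T t x).

(** Perturbations x of xbar b can be pulled back along trajectories to perturbations
    z of xbar a of comparable size and no larger value, in such a way that the
    pairing with the costate drops from a to b by at most a quadratic error. *)
Definition transports a b (q q' : 'rV[R]_n) :=
  exists E C d : R, [/\ 0 < E, 0 <= C, 0 < d &
    forall x, enorm (x - xbar b) < d -> exists z,
      [/\ V a z <= V b x, enorm (z - xbar a) <= E * enorm (x - xbar b)
        & dot q (z - xbar a) - dot q' (x - xbar b)
            <= C * enorm (x - xbar b) ^+ 2]].

Lemma dim_gt0 : (0 < n)%N.
Proof. by case: (n) e0 e00 => // p0; rewrite [p0]thinmx0 eqxx. Qed.

(** The tube of radius one around xbar stays in a fixed ball, from which the local
    constants of F and H are taken. *)
Let tube : exists2 rho : R, 0 < rho &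
  forall s x, t0 <= s <= T -> enorm (x - xbar s) <= 1 -> enorm x <= rho.
Proof.
have [B B0 BP] := trajectory_bounded hSH x0 t0 T.
exists (B + 1) => [|s x sT xs]; first by rewrite ltr_wpDl.
by rewrite -(subrK (xbar s) x) (le_trans (enormD _ _))// addrC lerD// (BP _ txbar).
Qed.

Let xbar_in_tube rho s : (forall s x, t0 <= s <= T -> enorm (x - xbar s) <= 1 ->
  enorm x <= rho) -> t0 <= s <= T -> enorm (xbar s) <= rho.
Proof. by move=> H sT; apply: (H s) => //; rewrite subrr enorm0. Qed.

Let tube_cball rho x : enorm x <= rho -> cball 0 (n%:R * rho) x.
Proof.
move=> xr; rewrite -(vclamp_id xr); apply: vclamp_cball.
exact: le_trans (enorm_ge0 _) xr.
Qed.

(** The inclusion for the costate bounds its derivative by k |pbar|, because H is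
    Lipschitz in x with constant k |p|. Hence pbar vanishes everywhere or
    nowhere. *)
Lemma adjoint_gronwall : exists2 k : R, 0 <= k & forall s t, t0 <= s -> s <= t ->
  t <= T -> enorm (pbar s) <= expR (k * (t - s)) * enorm (pbar t) /\
    enorm (pbar t) <= expR (k * (t - s)) * enorm (pbar s).
Proof.
have [rho rho0 rhoP] := tube.
have r0 : 0 < n%:R * rho by rewrite mulr_gt0// ltr0n dim_gt0.
have [k k0 kP] := gradient_lipP hH r0; exists k => //.
apply: arc_gronwall => //; apply: ae_imp hsys => s H sT.
have [_ dp _ Hq] := H sT; exists (derive1 pbar s); first exact: is_derive_derive1.
rewrite in_itv/= in sT; rewrite -enormN.
apply: (subgradient_bound _ ltr01 _ Hq); first by rewrite mulr_ge0 ?enorm_ge0.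
move=> y ys /=; apply: (hamiltonian_lip hSH hH _ kP); apply: tube_cball.
  by apply: (rhoP s) => //; exact: ltW.
exact: (xbar_in_tube rhoP).
Qed.

(** Perturbations flow backwards along the gradient field of the costate pbar, for
    which xbar is itself a solution. By the maximality of the gradient, the
    derivative of dot (pbar s) (y s - xbar s) is
    H y pbar - H xbar pbar + dot pbar' (y - xbar), which semiconvexity bounds
    below by a multiple of - |y - xbar|^2. *)
Lemma transport_adjoint a b : t0 <= a -> a <= b -> b <= T ->
  (forall s, a <= s <= b -> pbar s != 0) -> transports a b (pbar a) (pbar b).
Proof.
move=> ta ab bT pn0; have [rho rho0 rhoP] := tube.
have r0 : 0 < n%:R * rho by rewrite mulr_gt0// ltr0n dim_gt0.
have [k k0 kP] := gradient_lipP hH r0.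
have [c c0 cP] := hamiltonian_semiconvex hSH hH r0.
have sub s : a <= s <= b -> t0 <= s <= T.
  by move=> /andP[as_ sb]; rewrite (le_trans ta as_) (le_trans sb bT).
have apb : is_arc a b pbar by exact: is_arc_sub apbar.
have axb : is_arc a b xbar by case: txbar => + _ _; exact: is_arc_sub.
have [P P0 pP] := arc_bounded ab apb.
pose E := expR (k * (b - a)); have E0 : 0 < E by exact: expR_gt0.
pose pc s := pbar (clamp a b s).
have pc0 s : pc s != 0 by apply: pn0; exact: clamp_itv.
pose f s y := gradient (hamiltonian F y) (pc s).
have fsel s : lip_selection F (n%:R * rho) k (f s).
  exact: lip_selection_gradient.
have fcont (y : 'rV[R]_n) : continuous (f^~ y).
  move=> s; apply/cvgrPdist_lt => e e_gt0.
  have [d d0 dP] := gradient_continuous hSH hH y (pc0 s) e_gt0.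
  have [d' d'0 d'P] := is_arc_clamp_continuous ab apb s d0.
  apply/nbhs_ballP; exists d' => //= t; rewrite /ball/= distrC => /d'P/(dP _ (pc0 t)).
  by rewrite enorm_sym; apply: le_lt_trans; exact: norm_le_enorm.
exists E, (c * P * E ^+ 2 * (b - a)), (E^-1); split=> //.
- by rewrite !mulr_ge0 ?subr_ge0// ltW.
- by rewrite invr_gt0.
move=> x xd; set d := enorm (x - xbar b) in xd *.
have Ed : E * d <= 1 by rewrite -ler_pdivlMl// mulr1 ltW.
have d0 : 0 <= d by exact: enorm_ge0.
have [y yb dy] := selection_flow hSH b x (ltW rho0) k0 fsel (fun v _ => fcont v).
have [_ _ [gam gam0 gamP]] := hSH.
have ay : is_arc a b y.
  apply: (@is_arc_lip _ _ _ _ _ (gam * (1 + n%:R * rho))).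
  apply: (@derive_lip _ _ a b y (fun s => f s (vclamp rho (y s)))) => // s sab.
  have [/(_ _ (vclamp_cball (y s) (ltW rho0))) Ff _] := fsel s.
  rewrite (le_trans (gamP _ _ Ff))// ler_wpM2l ?(ltW gam0)// lerD2l.
  by have := vclamp_cball (y s) (ltW rho0); rewrite /cball/= subr0.
pose e s := y s - xbar s.
have ae : is_arc a b e by exact: is_arcB.
(* The costate is nonzero, so the velocity of xbar is the gradient of H. *)
have dxbar : {ae (@lebesgue_measure R), forall s, s \in `[a, b] ->
    is_derive s (1 : R) xbar (f s (vclamp rho (xbar s)))}.
  apply: ae_imp hsys => s H; rewrite in_itv/= => sab.
  have [|dx _ Hx _] := H; first by rewrite in_itv/= sub.
  rewrite vclamp_id; last by apply: (xbar_in_tube rhoP); exact: sub.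
  rewrite /f /pc clamp_id// -(gradient_subgradient hH (pn0 s sab) Hx).
  exact: is_derive_derive1.
have eE s : a <= s <= b -> enorm (e s) <= E * d.
  move=> /andP[as_ sb].
  have H : {ae (@lebesgue_measure R), forall s, s \in `[a, b] ->
      exists2 v, is_derive s (1 : R) e v & enorm v <= k * enorm (e s)}.
    apply: ae_imp dxbar => r H rab.
    exists (f r (vclamp rho (y r)) - f r (vclamp rho (xbar r))).
      exact: is_deriveB (dy r) (H rab).
    have [_ /(_ _ _ (vclamp_cball (y r) (ltW rho0)) (vclamp_cball (xbar r) (ltW rho0)))] := fsel r.
    by move=> /le_trans; apply; rewrite ler_wpM2l// vclamp_lip.
  have [+ _] := arc_gronwall k0 ae H as_ sb (lexx b).
  rewrite {2}/e yb -/d => /le_trans; apply; rewrite ler_wpM2r// ler_expR.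
  by rewrite ler_wpM2l// lerD2l lerN2.
have yrho s : a <= s <= b -> enorm (y s) <= rho.
  move=> sab; apply: (rhoP s); first exact: sub.
  by rewrite (le_trans (eE s sab)).
exists (y a); split.
- rewrite -yb; apply: (value_le_trajectory hSH hH hphi e00 ab bT).
  exact: (flow_trajectory hSH fsel (ltW rho0) dy yrho).
- by apply: eE; rewrite lexx.
rewrite -yb -/(e a) -/(e b).
pose K := c * P * (E * d) ^+ 2.
suff : dot (pbar a) (e a) + K * a <= dot (pbar b) (e b) + K * b.
  by rewrite /K exprMn; lra.
apply: (@abs_cont_ndecr _ _ _ (fun s => dot (pbar s) (e s) + K * s)) => //.
  apply: abs_contD; first exact: abs_cont_dot.
  apply: abs_contM => //; first exact: abs_cont_cst.
  by apply: (@abs_cont_lip _ _ _ _ 1) => s t _ st _; rewrite ger0_norm ?subr_ge0// mul1r.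
apply: ae_imp2 dxbar hsys => s dx H sab; have := sab; rewrite in_itv/= => sab'.
have [|_ dp Hx Hq] := H; first by rewrite in_itv/= sub.
have de : is_derive s (1 : R) e
    (f s (vclamp rho (y s)) - f s (vclamp rho (xbar s))).
  exact: is_deriveB (dy s) (dx sab).
have dK : is_derive s (1 : R) (fun t : R => K * t) (K *: 1) by apply: is_deriveZ.
have dq := is_deriveD (is_derive_dot (is_derive_derive1 dp) de) dK.
split; first by have := dq.
rewrite derive1E (@derive_val _ _ _ _ _ _ _ dq) /GRing.scale/= mulr1.
have xrho : enorm (xbar s) <= rho by apply: (xbar_in_tube rhoP); exact: sub.
rewrite !vclamp_id ?yrho// /f /pc clamp_id// (dotBr _ _ (pbar s)) !(dotC (pbar s)).
have [_ ->] := gradientP hSH hH (y s) (pn0 s sab').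
have [_ ->] := gradientP hSH hH (xbar s) (pn0 s sab').
have := cP _ _ _ _ (tube_cball xrho) (tube_cball (yrho s sab')) Hq (pn0 s sab').
rewrite dotNl -/(e s).
have : c * enorm (pbar s) * enorm (e s) ^+ 2 <= K.
  apply: ler_pM; rewrite ?mulr_ge0 ?sqr_ge0 ?enorm_ge0//.
    by rewrite ler_wpM2l// pP.
  rewrite ler_sqr ?nnegrE ?enorm_ge0// ?mulr_ge0 ?(ltW E0)//.
  exact: eE.
lra.
Qed.

(** One step of a polygonal Filippov argument. The mean velocity w of xbar over the
    step almost belongs to F (xbar s'), so some Lipschitz selection is close to
    w there; following it backwards from z reproduces the displacement of xbar
    up to second order in the step and a Lipschitz amplification of the initial
    error. *)
Lemma tracking_step : exists k M C : R, [/\ 0 <= k, 0 <= M, 0 <= C &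
  forall s s' z, t0 <= s -> s < s' -> s' <= T ->
    enorm (z - xbar s') + M * (s' - s) <= 1 -> exists z',
      V s z' <= V s' z /\
      enorm (z' - xbar s) <=
        (1 + k * (s' - s)) * enorm (z - xbar s') + C * (s' - s) ^+ 2].
Proof.
have [rho rho0 rhoP] := tube.
have r0 : 0 < n%:R * rho by rewrite mulr_gt0// ltr0n dim_gt0.
have [k k0 kP] := gradient_lipP hH r0.
have [_ _ [gam gam0 gamP]] := hSH.
have [M M0 FM] : exists2 M : R, 0 <= M &
    forall x v, cball 0 (n%:R * rho) x -> F x v -> enorm v <= M.
  exists (gam * (1 + n%:R * rho)).
    by rewrite mulr_ge0 ?(ltW gam0)// addr_ge0// ltW.
  move=> x v; rewrite /cball/= subr0 => xr Fv.
  by rewrite (le_trans (gamP _ _ Fv))// ler_wpM2l ?(ltW gam0)// lerD2l.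
exists k, M, (2 * k * M + 1); split=> //.
  by rewrite addr_ge0// !mulr_ge0.
move=> s s' z ts ss' s'T; set h := s' - s; set D := enorm _ => DM.
have h0 : 0 < h by rewrite subr_gt0.
have s'in : t0 <= s' <= T by rewrite s'T (le_trans ts (ltW ss')).
have xrho t : t0 <= t <= T -> enorm (xbar t) <= rho by exact: (xbar_in_tube rhoP).
have [axb _ _] := txbar.
have xlip : forall t u, t0 <= t -> t <= u -> u <= T ->
    enorm (xbar u - xbar t) <= M * (u - t).
  apply: arc_lip => //; apply: ae_imp (trajectory_derive txbar) => t H tT.
  have [v xv Fv] := H tT; exists v => //; apply: FM Fv; apply: tube_cball; exact: xrho.
pose w := h^-1 *: (xbar s' - xbar s).
have wH p : dot w p <= hamiltonian F (xbar s') p + k * M * h * enorm p.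
  rewrite /w dotZl -ler_pdivlMl ?invr_gt0// invrK mulrC.
  apply: arc_increment_le; [exact: ltW|exact: is_arc_sub axb|].
  apply: ae_imp (trajectory_derive txbar) => t H; rewrite in_itv/= => /andP[st ts'].
  have tT : t0 <= t <= T by rewrite (le_trans ts st) (le_trans ts' s'T).
  have [|v xv Fv] := H; first by rewrite in_itv.
  exists v => //; rewrite (le_trans (hamiltonian_ub hSH p Fv))// -lerBlDl.
  have := hamiltonian_lip hSH hH p kP (tube_cball (xrho t tT)) (tube_cball (xrho s' s'in)).
  move=> /le_trans; apply; rewrite -[k * M * h]mulrA [leRHS]mulrAC.
  rewrite ler_wpM2l ?mulr_ge0 ?enorm_ge0// enorm_sym.
  rewrite (le_trans (xlip t s' _ _ _))//; first by case/andP: tT.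
  by rewrite ler_wpM2l// lerD2l lerN2.
have [f fsel fw] := lip_selection_approx hSH hH kP e00 (tube_cball (xrho s' s'in))
  (mulr_ge0 (mulr_ge0 k0 M0) (ltW h0)) h0 wH.
have [y ys' dy] := @selection_flow _ _ F hSH rho k (fun=> f) s' z (ltW rho0) k0
  (fun=> fsel) (fun _ _ _ => cvg_cst _).
have Ff t : F (vclamp rho (y t)) (f (vclamp rho (y t))).
  by have [+ _] := fsel; apply; apply: vclamp_cball; exact: ltW.
have ylip : forall t u, s <= t -> t <= u -> u <= s' ->
    enorm (y u - y t) <= M * (u - t).
  apply: (@derive_lip _ _ s s' y (fun t => f (vclamp rho (y t)))) => // t _.
  by apply: FM (Ff t); apply: vclamp_cball; exact: ltW.
have ynear t : s <= t <= s' -> enorm (y t - xbar s') <= D + M * h.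
  move=> /andP[st ts']; rewrite (le_trans (enorm_triangle z _ _))// addrC lerD2l.
  rewrite -ys' enorm_sym (le_trans (ylip t s' st ts' (lexx _)))//.
  by rewrite ler_wpM2l// lerD2l lerN2.
have yrho t : s <= t <= s' -> enorm (y t) <= rho.
  by move=> st; apply: (rhoP s') => //; rewrite (le_trans (ynear t st)).
exists (y s); split.
  rewrite -ys'; apply: (value_le_trajectory hSH hH hphi e00 (ltW ss') s'T).
  exact: (flow_trajectory hSH (fun=> fsel) (ltW rho0) dy yrho).
set v := f (xbar s').
have drift : enorm (y s' - s' *: v - (y s - s *: v)) <= k * (D + M * h) * h.
  apply: (@derive_lip _ _ s s' (fun t => y t - t *: v)
    (fun t => f (vclamp rho (y t)) - v)) => //; last exact: ltW.
    move=> t _; have dv : is_derive t (1 : R) (fun t : R => t *: v) v.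
      apply: is_derive_rowP => i; rewrite (_ : (fun _ => _) = fun r => v 0 i * r).
        apply: (is_derive_subst (is_deriveZ (v 0 i) (is_derive_id t (1 : R)))).
        by rewrite /GRing.scale/= mulr1.
      by apply/funext => r; rewrite mxE mulrC.
    exact: is_deriveB (dy t) dv.
  move=> t st; have [_ fL] := fsel; rewrite vclamp_id ?yrho//.
  rewrite (le_trans (fL _ _ (tube_cball (yrho t st)) (tube_cball (xrho s' s'in))))//.
  by rewrite ler_wpM2l// ynear.
have hw : h *: w = xbar s' - xbar s by rewrite scalerA mulfV ?scale1r// gt_eqF.
have -> : y s - xbar s = (z - xbar s') - (y s' - s' *: v - (y s - s *: v))
    - h *: (v - w).
  rewrite scalerBr hw ys' /h; apply/rowP => i; rewrite !mxE; ring.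
rewrite (le_trans (enormD _ _))// enormN enormZ (gtr0_norm h0).
have := enormD (z - xbar s') (- (y s' - s' *: v - (y s - s *: v))).
rewrite enormN -/D; have := ler_wpM2l (ltW h0) (ltW fw); rewrite expr2; lra.
Qed.

(** When the costate vanishes only the size of the perturbation matters. Small steps
    of [tracking_step] accumulate an error proportional to the initial one. *)
Lemma transport_tracking a b : t0 <= a -> a <= b -> b <= T -> transports a b 0 0.
Proof.
move=> ta ab bT; have [k [M [C [k0 M0 C0 step]]]] := tracking_step.
pose E := expR (k * (b - a)) * (1 + C * (b - a)).
have E0 : 0 < E by rewrite mulr_gt0 ?expR_gt0// ltr_pwDl// mulr_ge0// subr_ge0.
have EM0 : 0 < E + M by rewrite ltr_pwDl.
exists E, 0, (E + M)^-1; split=> //; first by rewrite invr_gt0.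
move=> x; set d := enorm _ => xd.
suff [z [Vz zE]] : exists z, V a z <= V b x /\ enorm (z - xbar a) <= E * d.
  by exists z; split=> //; rewrite !dot0l subrr mul0r.
have EMd : (E + M) * d <= 1 by rewrite -ler_pdivlMl// mulr1 ltW.
have d0 : 0 <= d := enorm_ge0 _.
move: d0; rewrite le_eqVlt => /orP[/eqP d0|d0].
  have -> : x = xbar b by apply/eqP; rewrite -subr_eq0 -enorm_eq0 -/d -d0.
  exists (xbar a); rewrite subrr enorm0 -d0 mulr0; split=> //.
  exact: (value_le_trajectory hSH hH hphi e00 ab bT (trajectory_sub txbar ta bT)).
move: (ab); rewrite le_eqVlt => /orP[/eqP abE|ltab].
  exists x; rewrite abE; split=> //; rewrite -/d ler_peMl ?(ltW d0)//.
  by rewrite /E abE subrr !mulr0 expR0 addr0 mulr1.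
(* Each step adds an error of order h^2, so the total is of order h <= d. *)
pose N := (Num.bound `|(b - a) / d|).+1; pose h := (b - a) / N%:R.
have N0 : 0 < N%:R :> R by rewrite ltr0n.
have h0 : 0 < h by rewrite divr_gt0// subr_gt0.
have hge0 : 0 <= h by exact: ltW.
have dge0 : 0 <= d by exact: ltW.
have hd : h <= d.
  rewrite /h ler_pdivrMr// mulrC -ler_pdivrMr//.
  rewrite (le_trans (ler_norm _))// ltW//.
  apply: lt_le_trans (archimedean.Num.Theory.archi_boundP (normr_ge0 _)) _.
  by rewrite ler_nat.
have hN : h * N%:R = b - a by rewrite divfK// gt_eqF.
have bound j : (j <= N)%N ->
    expR (k * (j%:R * h)) * (d + C * (j%:R * h) * h) <= E * d.
  move=> jN; have jh : j%:R * h <= b - a.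
    by rewrite -hN mulrC ler_wpM2l ?(ltW h0)// ler_nat.
  have jh0 : 0 <= j%:R * h by rewrite mulr_ge0// ltW.
  rewrite /E -[leRHS]mulrA; apply: ler_pM; rewrite ?expR_ge0//.
  - by rewrite addr_ge0// mulr_ge0// mulr_ge0.
  - by rewrite ler_expR ler_wpM2l.
  - rewrite mulrDl mul1r lerD2l; apply: ler_pM => //; first by rewrite mulr_ge0.
    by rewrite ler_wpM2l.
suff /(_ N (leqnn _))[z [Vz zE]] : forall j, (j <= N)%N -> exists z,
    V (b - j%:R * h) z <= V b x /\ enorm (z - xbar (b - j%:R * h)) <=
      expR (k * (j%:R * h)) * (d + C * (j%:R * h) * h).
  exists z; have aE : b - N%:R * h = a by rewrite mulrC hN; ring.
  by rewrite aE in Vz zE; split=> //; exact: le_trans zE (bound _ _).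
elim=> [_|j IH jN].
  by exists x; rewrite !mul0r subr0 mulr0 expR0 mul1r mulr0 mul0r addr0.
have [z [Vz zE]] := IH (ltnW jN).
have jS : j.+1%:R * h = j%:R * h + h by rewrite -natr1; ring.
have jh0 : 0 <= j%:R * h by rewrite mulr_ge0// ltW.
have jN' : j.+1%:R * h <= b - a.
  by rewrite -hN mulrC ler_wpM2l ?(ltW h0)// ler_nat.
set s' := b - j%:R * h in Vz zE *; set s := b - j.+1%:R * h.
have s'sh : s' - s = h by rewrite /s /s' jS; ring.
have [||||z' [Vz' z'E]] := step s s' z.
- by rewrite /s; lra.
- by rewrite -subr_gt0 s'sh.
- by rewrite /s'; lra.
- rewrite s'sh; have := le_trans zE (bound j (ltnW jN)).
  have : M * h <= M * d by rewrite ler_wpM2l.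
  by move: EMd; rewrite mulrDl; lra.
exists z'; split; first exact: le_trans Vz.
apply: le_trans z'E _; rewrite s'sh jS.
have k1 : 1 + k * h <= expR (k * h) by exact: expR_ge1Dx.
set A := j%:R * h in zE jh0 *; set X := d + C * A * h in zE.
have X0 : 0 <= X by rewrite addr_ge0// mulr_ge0// mulr_ge0.
have kh0 : 0 <= k * h by rewrite mulr_ge0// ltW.
have -> : d + C * (A + h) * h = X + C * h ^+ 2 by rewrite /X; ring.
rewrite [leRHS]mulrDr; apply: lerD; last first.
  apply: ler_peMl; first by rewrite mulr_ge0// sqr_ge0.
  by rewrite -expR0 ler_expR mulr_ge0// addr_ge0.
have -> : expR (k * (A + h)) = expR (k * A) * expR (k * h).
  by rewrite -expRD mulrDr.
rewrite [leRHS]mulrAC [leRHS]mulrC.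
apply: ler_pM => //; first by rewrite addr_ge0.
exact: enorm_ge0.
Qed.

End transport.

(** * The sensitivity relation *)

Theorem theorem3p2 (R : realType) (n : nat) (T : R)
    (F : 'rV[R]_n -> set 'rV[R]_n) (phi : 'rV[R]_n -> R)
    (hSH : SH F) (hH : HH F) (hphi : locally_lipschitz phi)
    (t0 : R) (x0 : 'rV[R]_n) (ht0 : t0 <= T)
    (xbar pbar : R -> 'rV[R]_n)
    (hopt : optimal F phi T t0 x0 xbar)
    (harc : is_arc t0 T pbar)
    (hsys : {ae (@lebesgue_measure R), forall s : R, s \in `[t0, T] ->
       [/\ derivable xbar s 1, derivable pbar s 1,
           frechet_subdiff (fun p => hamiltonian F (xbar s) p) (pbar s)
             (derive1 xbar s)
         & frechet_subdiff (fun x => hamiltonian F x (pbar s)) (xbar s)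
             (- derive1 pbar s)]})
    (hx0 : xbar t0 = x0)
    (hp0 : frechet_subdiff (fun x => value F phi T t0 x) x0 (- pbar t0)) :
  forall t : R, t0 <= t <= T ->
    frechet_subdiff (fun x => value F phi T t x) (xbar t) (- pbar t).
Proof.
move=> t /andP[t0t tT].
have [n0|npos] := posnP n.
  subst n; apply/frechet_subdiffP => e e0; exists 1 => // y _.
  by rewrite [y]thinmx0 [xbar t]thinmx0 !subrr enorm0 dot0r mulr0 subrr oppr0.
pose e0 : 'rV[R]_n := const_mx 1.
have e00 : e0 != 0.
  apply/eqP => /rowP/(_ (Ordinal npos)); rewrite !mxE => /eqP.
  by rewrite oner_eq0.
have [txbar xmin] := hopt.
have [E [C [d [E0 C0 d0 dP]]]] :
    transports F phi T xbar t0 t (pbar t0) (pbar t).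
  (* A costate that vanishes somewhere vanishes at both end points. *)
  have [[s [/andP[t0s st] ps]]|pn0] := pselect (exists s, t0 <= s <= t /\ pbar s = 0).
    have [k k0 kP] := adjoint_gronwall hSH hH e00 txbar harc hsys.
    have sT := le_trans st tT.
    have [+ _] := kP t0 s (lexx _) t0s sT.
    have [_ +] := kP s t t0s st tT.
    rewrite ps enorm0 !mulr0 => pt pt0.
    have -> : pbar t = 0 by apply/eqP; rewrite -enorm_eq0 eq_le pt enorm_ge0.
    have -> : pbar t0 = 0 by apply/eqP; rewrite -enorm_eq0 eq_le pt0 enorm_ge0.
    exact: (transport_tracking hSH hH hphi e00 txbar (lexx _) t0t tT).
  apply: (transport_adjoint hSH hH hphi e00 txbar harc hsys (lexx _) t0t tT).
  by move=> s st; apply/eqP => ps; apply: pn0; exists s.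
(* The value does not increase along the optimal trajectory. *)
have Vt : value F phi T t (xbar t) <= value F phi T t0 (xbar t0).
  apply: (@le_trans _ _ (phi (xbar T))).
    apply: (value_le_payoff hSH hphi tT).
    exact: trajectory_sub txbar t0t (lexx _).
  rewrite hx0; apply: lb_le_inf; first by exists (phi (xbar T)), xbar.
  by move=> _ [z /xmin xz <-].
apply/frechet_subdiffP => e e_gt0.
have e2E : 0 < e / 2 / E by rewrite !divr_gt0.
move/frechet_subdiffP/(_ _ e2E) : hp0 => [r r0 rP].
have C1 : 0 < C + 1 by rewrite ltr_wpDl.
exists (Num.min d (Num.min (r / E) (e / 2 / (C + 1)))).
  by rewrite !lt_min d0 !divr_gt0.
move=> x; rewrite !lt_min => /and3P[xd xr xe]; set D := enorm _ in xd xr xe *.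
have D0 : 0 <= D by exact: enorm_ge0.
have [z [Vz zE zp]] := dP x xd.
have zr : enorm (z - x0) < r.
  by rewrite -hx0 (le_lt_trans zE)// mulrC -ltr_pdivlMr.
have := rP z zr; rewrite !dotNl -hx0 => h1.
have h2 : e / 2 / E * enorm (z - xbar t0) <= e / 2 * D.
  by rewrite -mulrA ler_wpM2l ?divr_ge0 ?(ltW e_gt0)// mulrC ler_pdivrMr// mulrC.
have h3 : C * D ^+ 2 <= e / 2 * D.
  rewrite expr2 mulrA ler_wpM2r//.
  move: xe; rewrite ltr_pdivlMr// => xe; move: D0 xe; lra.
move: h1 h2 h3 zp; rewrite -/D; lra.
Qed.
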